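(* Let $E$ be a directed graph with finitely many vertices and let $K$ be a field. With respect to the natural $\mathbb{Z}$-grading of the Leavitt path algebra $L_K(E)$, the following are equivalent. (1) $L_K(E)$ is a crossed product. (2) $E$ is a finite no-exit graph without sinks such that Condition (EDL) holds. (3) $L_K(E)$ is strongly graded and graded unit-regular.
   Context: **Graphs.** A directed graph $E$ has vertex set $E^0$, edge set $E^1$, source map $\mathbf{s}$ and range map $\mathbf{r}$. It is finite if $E^0$ and $E^1$ are finite. A vertex $v$ is a sink if $\mathbf{s}^{-1}(v)=\emptyset$ and regular if $\mathbf{s}^{-1}(v)$ is finite and nonempty. A cycle is a closed path such that different edges in the path have different sources. A cycle has an exit if a vertex on the cycle emits an edge outside of the cycle. $E$ is no-exit if no cycle has an exit. Paths include those of length $0$ (vertices). **Condition (EDL).** For every cycle of length $m$, the lengths, considered modulo $m$, of all paths which do not contain the cycle and which end in an arbitrary but fixed vertex of the cycle are $k(0),\ldots,k(m-1)$ for some positive integer $k$, i.e. each residue $0,\ldots,m-1$ modulo $m$ occurs exactly $k$ times. **Leavitt path algebra.** $L_K(E)$ is the free $K$-algebra generated by $E^0\cup E^1\cup\{e^*\mid e\in E^1\}$ subject to, for all vertices $v,w$ and edges $e,f$: $vw=0$ if $v\ne w$ and $vv=v$; $\mathbf{s}(e)e=e\mathbf{r}(e)=e$; $\mathbf{r}(e)e^*=e^*\mathbf{s}(e)=e^*$; $e^*f=0$ if $e\neq f$ and $e^*e=\mathbf{r}(e)$; $v=\sum_{e\in\mathbf{s}^{-1}(v)}ee^*$ for each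 regular vertex $v$. Its natural $\mathbb{Z}$-grading has $n$-component the $K$-span of all $pq^*$ with $p,q$ paths and $|p|-|q|=n$, where $|p|$ is the length of $p$. Since $E^0$ is finite, $L_K(E)$ is unital. **Graded notions.** Let $R=\bigoplus_{\gamma\in\Gamma}R_\gamma$ be a unital ring graded by a group $\Gamma$. $R$ is strongly graded if $R_\gamma R_\delta=R_{\gamma\delta}$ for all $\gamma,\delta\in\Gamma$. $R$ is a crossed product if each $R_\gamma$ contains an invertible element of $R$. $R$ is graded unit-regular if for every $\gamma\in\Gamma$ and every nonzero $a\in R_\gamma$ there is an invertible element $u\in R_{\gamma^{-1}}$ such that $a=aua$. *)

(* Defs.v *)
From HB Require Import structures.
From mathcomp Require Import all_boot all_algebra.
From mathcomp Require Import boolp classical_sets functions cardinality.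

Set Implicit Arguments.
Unset Strict Implicit.
Unset Printing Implicit Defensive.

Import GRing.Theory.
Local Open Scope ring_scope.
Local Open Scope classical_set_scope.
Local Open Scope card_scope.


(* The edge type may be infinite.  [choiceType] is no restriction: classically
   (boolp.gen_eqMixin, boolp.gen_choiceMixin) every type is one. *)
Record digraph := Digraph {
  vert : finType;
  edge : choiceType;
  src : edge -> vert;
  rng : edge -> vert }.

Section Graph.
Variable E : digraph.
Implicit Types (v w : vert E) (e f : edge E) (p c : seq (edge E)).

Definition finite_graph := finite_set [set: edge E].

Definition sink v := forall e, src e <> v.

Definition no_sinks := forall v, ~ sink v.

(* [(w, p)] is a path: the edges [p] are composable and start at [w].  The
   vertex is recorded because [p] may be empty. *)
Fixpoint is_path w p : bool :=
  if p is e :: p' then (src e == w) && is_path (rng e) p' else true.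

Definition path_end w p : vert E := last w [seq rng e | e <- p].

(* Edges at different positions have different sources; in particular a loop
   run through twice is not a cycle.  Vertices are not cycles. *)
Definition is_cycle c : bool :=
  [&& c != [::], cycle (fun e f => rng e == src f) c & uniq [seq src e | e <- c]].

Definition on_cycle c v : bool := v \in [seq src e | e <- c].

Definition has_exit c := exists e, on_cycle c (src e) /\ e \notin c.

Definition no_exit := forall c, is_cycle c -> ~ has_exit c.

(* A cycle is considered up to the choice of its base vertex: to contain it is
   to go once around it along consecutive edges, from any of its vertices. *)
Definition contains_cycle c p : Prop := exists i : nat, infix (rot i c) p.

Definition EDL := forall c, is_cycle c -> forall v, on_cycle c v ->
  exists2 k : nat, (0 < k)%N &
    forall i : nat, (i < size c)%N ->
      [set wp : vert E * seq (edge E) |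
        [/\ is_path wp.1 wp.2, path_end wp.1 wp.2 = v,
            ~ contains_cycle c wp.2 & (size wp.2 %% size c)%N = i]] #= `I_k.

End Graph.


(* Expressions in the generators, and the least congruence on them containing
   the axioms of (not necessarily unital) associative K-algebras and the
   defining relations; the quotient is the presented K-algebra. *)
Inductive lpa_term (E : digraph) (K : fieldType) : Type :=
| tVert of vert E
| tEdge of edge E
| tGhost of edge E
| tZero
| tOpp of lpa_term E K
| tAdd of lpa_term E K & lpa_term E K
| tScale of K & lpa_term E K
| tMul of lpa_term E K & lpa_term E K.

Arguments tVert {E K}.
Arguments tEdge {E K}.
Arguments tGhost {E K}.
Arguments tZero {E K}.

Section Presentation.
Variables (E : digraph) (K : fieldType).
Local Notation term := (lpa_term E K).

Inductive lpa_eqv : term -> term -> Prop :=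
| eqv_refl x : lpa_eqv x x
| eqv_sym x y : lpa_eqv x y -> lpa_eqv y x
| eqv_trans y x z : lpa_eqv x y -> lpa_eqv y z -> lpa_eqv x z
| eqv_opp x x' : lpa_eqv x x' -> lpa_eqv (tOpp x) (tOpp x')
| eqv_add x x' y y' :
    lpa_eqv x x' -> lpa_eqv y y' -> lpa_eqv (tAdd x y) (tAdd x' y')
| eqv_scale a x x' : lpa_eqv x x' -> lpa_eqv (tScale a x) (tScale a x')
| eqv_mul x x' y y' :
    lpa_eqv x x' -> lpa_eqv y y' -> lpa_eqv (tMul x y) (tMul x' y')
| eqv_addA x y z : lpa_eqv (tAdd x (tAdd y z)) (tAdd (tAdd x y) z)
| eqv_addC x y : lpa_eqv (tAdd x y) (tAdd y x)
| eqv_add0 x : lpa_eqv (tAdd tZero x) x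
| eqv_addN x : lpa_eqv (tAdd (tOpp x) x) tZero
| eqv_scaleA a b x : lpa_eqv (tScale a (tScale b x)) (tScale (a * b) x)
| eqv_scale1 x : lpa_eqv (tScale 1 x) x
| eqv_scaleDr a x y :
    lpa_eqv (tScale a (tAdd x y)) (tAdd (tScale a x) (tScale a y))
| eqv_scaleDl a b x :
    lpa_eqv (tScale (a + b) x) (tAdd (tScale a x) (tScale b x))
| eqv_mulA x y z : lpa_eqv (tMul x (tMul y z)) (tMul (tMul x y) z)
| eqv_mulDl x y z : lpa_eqv (tMul (tAdd x y) z) (tAdd (tMul x z) (tMul y z))
| eqv_mulDr x y z : lpa_eqv (tMul x (tAdd y z)) (tAdd (tMul x y) (tMul x z))
| eqv_scaleAl a x y : lpa_eqv (tScale a (tMul x y)) (tMul (tScale a x) y)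
| eqv_scaleAr a x y : lpa_eqv (tScale a (tMul x y)) (tMul x (tScale a y))
| eqv_vert v : lpa_eqv (tMul (tVert v) (tVert v)) (tVert v)
| eqv_vert_orth v w : v <> w -> lpa_eqv (tMul (tVert v) (tVert w)) tZero
| eqv_src_edge e : lpa_eqv (tMul (tVert (src e)) (tEdge e)) (tEdge e)
| eqv_edge_rng e : lpa_eqv (tMul (tEdge e) (tVert (rng e))) (tEdge e)
| eqv_rng_ghost e : lpa_eqv (tMul (tVert (rng e)) (tGhost e)) (tGhost e)
| eqv_ghost_src e : lpa_eqv (tMul (tGhost e) (tVert (src e))) (tGhost e)
| eqv_ghost_edge e : lpa_eqv (tMul (tGhost e) (tEdge e)) (tVert (rng e))
| eqv_ghost_orth e f : e <> f -> lpa_eqv (tMul (tGhost e) (tEdge f)) tZero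
(* such an [s], which enumerates the edges emitted by [v], exists exactly when
   [v] is regular *)
| eqv_regular v (s : seq (edge E)) :
    s <> [::] -> uniq s -> (forall e, (e \in s) = (src e == v)) ->
    lpa_eqv (tVert v)
      (foldr (fun e x => tAdd (tMul (tEdge e) (tGhost e)) x) tZero s).

HB.instance Definition _ := gen_eqMixin term.
HB.instance Definition _ := gen_choiceMixin term.

Definition lpa_rel : rel term := fun x y => `[< lpa_eqv x y >].

Lemma lpa_rel_refl : reflexive lpa_rel.
Proof. by move=> x; apply/asboolP; exact: eqv_refl. Qed.

Lemma lpa_rel_sym : symmetric lpa_rel.
Proof. by move=> x y; apply/asboolP/asboolP; exact: eqv_sym. Qed.

Lemma lpa_rel_trans : transitive lpa_rel.
Proof.
by move=> y x z /asboolP xy /asboolP yz; apply/asboolP; exact: eqv_trans yz.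
Qed.

Canonical lpa_equiv := EquivRel lpa_rel lpa_rel_refl lpa_rel_sym lpa_rel_trans.

Local Open Scope quotient_scope.

Definition lpa : Type := {eq_quot lpa_equiv}.

HB.instance Definition _ := Choice.on lpa.
HB.instance Definition _ := EqQuotient.on lpa.

Definition lpa_pi (x : term) : lpa := \pi_lpa x.

Lemma lpa_piP x y : lpa_pi x = lpa_pi y <-> lpa_eqv x y.
Proof.
by split => [/eqmodP/asboolP|xy] //; apply/eqmodP/asboolP.
Qed.

Lemma lpa_ind (P : lpa -> Prop) : (forall x, P (lpa_pi x)) -> forall a, P a.
Proof. by move=> PP; elim/quotW => x; exact: PP. Qed.

Definition lpa_zero := lpa_pi tZero.
Definition lpa_opp (a : lpa) := lpa_pi (tOpp (repr a)).
Definition lpa_add (a b : lpa) := lpa_pi (tAdd (repr a) (repr b)).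
Definition lpa_scale (k : K) (a : lpa) := lpa_pi (tScale k (repr a)).
Definition lpa_mul (a b : lpa) := lpa_pi (tMul (repr a) (repr b)).

Lemma lpa_repr x : lpa_eqv (repr (lpa_pi x)) x.
Proof. by apply/lpa_piP; exact: reprK. Qed.

Lemma lpa_oppE x : lpa_opp (lpa_pi x) = lpa_pi (tOpp x).
Proof. by apply/lpa_piP/eqv_opp/lpa_repr. Qed.

Lemma lpa_addE x y : lpa_add (lpa_pi x) (lpa_pi y) = lpa_pi (tAdd x y).
Proof. by apply/lpa_piP/eqv_add; exact: lpa_repr. Qed.

Lemma lpa_scaleE k x : lpa_scale k (lpa_pi x) = lpa_pi (tScale k x).
Proof. by apply/lpa_piP/eqv_scale/lpa_repr. Qed.

Lemma lpa_mulE x y : lpa_mul (lpa_pi x) (lpa_pi y) = lpa_pi (tMul x y).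
Proof. by apply/lpa_piP/eqv_mul; exact: lpa_repr. Qed.

Lemma lpa_addA : associative lpa_add.
Proof.
elim/lpa_ind=> x; elim/lpa_ind=> y; elim/lpa_ind=> z.
by rewrite !lpa_addE; apply/lpa_piP/eqv_addA.
Qed.

Lemma lpa_addC : commutative lpa_add.
Proof.
elim/lpa_ind=> x; elim/lpa_ind=> y.
by rewrite !lpa_addE; apply/lpa_piP/eqv_addC.
Qed.

Lemma lpa_add0 : left_id lpa_zero lpa_add.
Proof. by elim/lpa_ind=> x; rewrite lpa_addE; apply/lpa_piP/eqv_add0. Qed.

Lemma lpa_addN : left_inverse lpa_zero lpa_opp lpa_add.
Proof.
by elim/lpa_ind=> x; rewrite lpa_oppE lpa_addE; apply/lpa_piP/eqv_addN.
Qed.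

HB.instance Definition _ :=
  GRing.isZmodule.Build lpa lpa_addA lpa_addC lpa_add0 lpa_addN.

Lemma lpa_mulA : associative lpa_mul.
Proof.
elim/lpa_ind=> x; elim/lpa_ind=> y; elim/lpa_ind=> z.
by rewrite !lpa_mulE; apply/lpa_piP/eqv_mulA.
Qed.

Lemma lpa_mulDl : left_distributive lpa_mul +%R.
Proof.
elim/lpa_ind=> x; elim/lpa_ind=> y; elim/lpa_ind=> z.
by rewrite /GRing.add /= !(lpa_addE, lpa_mulE); apply/lpa_piP/eqv_mulDl.
Qed.

Lemma lpa_mulDr : right_distributive lpa_mul +%R.
Proof.
elim/lpa_ind=> x; elim/lpa_ind=> y; elim/lpa_ind=> z.
by rewrite /GRing.add /= !(lpa_addE, lpa_mulE); apply/lpa_piP/eqv_mulDr.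
Qed.

Lemma lpa_scaleA k l a : lpa_scale k (lpa_scale l a) = lpa_scale (k * l) a.
Proof.
by elim/lpa_ind: a => x; rewrite !lpa_scaleE; apply/lpa_piP/eqv_scaleA.
Qed.

Lemma lpa_scale1 : left_id 1 lpa_scale.
Proof. by elim/lpa_ind=> x; rewrite lpa_scaleE; apply/lpa_piP/eqv_scale1. Qed.

Lemma lpa_scaleDr : right_distributive lpa_scale +%R.
Proof.
move=> k; elim/lpa_ind=> x; elim/lpa_ind=> y.
by rewrite /GRing.add /= !(lpa_addE, lpa_scaleE); apply/lpa_piP/eqv_scaleDr.
Qed.

Lemma lpa_scaleDl a : {morph lpa_scale^~ a : k l / k + l}.
Proof.
move=> k l; elim/lpa_ind: a => x; rewrite !lpa_scaleE {2}/GRing.add /= lpa_addE.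
by apply/lpa_piP/eqv_scaleDl.
Qed.

HB.instance Definition _ := GRing.Zmodule_isLmodule.Build K lpa
  lpa_scaleA lpa_scale1 lpa_scaleDr lpa_scaleDl.

Definition lpa_vert (v : vert E) : lpa := lpa_pi (tVert v).
Definition lpa_edge (e : edge E) : lpa := lpa_pi (tEdge e).
Definition lpa_ghost (e : edge E) : lpa := lpa_pi (tGhost e).

Definition lpa_one : lpa := \sum_v lpa_vert v.

Lemma lpa_mul0l a : lpa_mul 0 a = 0.
Proof. by apply: (addIr (lpa_mul 0 a)); rewrite -lpa_mulDl !add0r. Qed.

Lemma lpa_mul0r a : lpa_mul a 0 = 0.
Proof. by apply: (addIr (lpa_mul a 0)); rewrite -lpa_mulDr !add0r. Qed.

Lemma lpa_mul_suml a (F : vert E -> lpa) :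
  lpa_mul (\sum_v F v) a = \sum_v lpa_mul (F v) a.
Proof.
apply: (big_morph (lpa_mul^~ a)) => [x y|]; [exact: lpa_mulDl|exact: lpa_mul0l].
Qed.

Lemma lpa_mul_sumr a (F : vert E -> lpa) :
  lpa_mul a (\sum_v F v) = \sum_v lpa_mul a (F v).
Proof.
apply: (big_morph (lpa_mul a)) => [x y|]; [exact: lpa_mulDr|exact: lpa_mul0r].
Qed.

Lemma lpa_vert_orth v w : v <> w -> lpa_mul (lpa_vert v) (lpa_vert w) = 0.
Proof. by move=> vw; rewrite lpa_mulE; apply/lpa_piP/eqv_vert_orth. Qed.

Lemma lpa_one_fixl v a : lpa_mul (lpa_vert v) a = a -> lpa_mul lpa_one a = a.
Proof.
move=> va; rewrite lpa_mul_suml (bigD1 v) //= va big1 ?addr0 // => w /eqP wv.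
by rewrite -va lpa_mulA lpa_vert_orth ?lpa_mul0l.
Qed.

Lemma lpa_one_fixr v a : lpa_mul a (lpa_vert v) = a -> lpa_mul a lpa_one = a.
Proof.
move=> va; rewrite lpa_mul_sumr (bigD1 v) //= va big1 ?addr0 // => w /eqP wv.
by rewrite -va -lpa_mulA lpa_vert_orth ?lpa_mul0r //; exact: nesym.
Qed.

Lemma lpa_mul1 : left_id lpa_one lpa_mul.
Proof.
elim/lpa_ind; elim=> [v|e|e||x IH|x IHx y IHy|k x IH|x IHx y IHy].
- by apply: (@lpa_one_fixl v); rewrite lpa_mulE; apply/lpa_piP/eqv_vert.
- by apply: (@lpa_one_fixl (src e)); rewrite lpa_mulE; apply/lpa_piP/eqv_src_edge.
- by apply: (@lpa_one_fixl (rng e)); rewrite lpa_mulE; apply/lpa_piP/eqv_rng_ghost.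
- exact: lpa_mul0r.
- rewrite -lpa_oppE; apply: (addIr (lpa_pi x)); rewrite -{2}IH -lpa_mulDr.
  by rewrite [_ + _]lpa_addN lpa_mul0r.
- by rewrite -lpa_addE lpa_mulDr IHx IHy.
- rewrite -lpa_scaleE -{2}IH; elim/lpa_ind: lpa_one => o.
  by rewrite !(lpa_scaleE, lpa_mulE); apply/lpa_piP/eqv_sym/eqv_scaleAr.
- by rewrite -lpa_mulE lpa_mulA IHx.
Qed.

Lemma lpa_mulr1 : right_id lpa_one lpa_mul.
Proof.
elim/lpa_ind; elim=> [v|e|e||x IH|x IHx y IHy|k x IH|x IHx y IHy].
- by apply: (@lpa_one_fixr v); rewrite lpa_mulE; apply/lpa_piP/eqv_vert.
- by apply: (@lpa_one_fixr (rng e)); rewrite lpa_mulE; apply/lpa_piP/eqv_edge_rng.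
- by apply: (@lpa_one_fixr (src e)); rewrite lpa_mulE; apply/lpa_piP/eqv_ghost_src.
- exact: lpa_mul0l.
- rewrite -lpa_oppE; apply: (addIr (lpa_pi x)); rewrite -{2}IH -lpa_mulDl.
  by rewrite [_ + _]lpa_addN lpa_mul0l.
- by rewrite -lpa_addE lpa_mulDl IHx IHy.
- rewrite -lpa_scaleE -{2}IH; elim/lpa_ind: lpa_one => o.
  by rewrite !(lpa_scaleE, lpa_mulE); apply/lpa_piP/eqv_sym/eqv_scaleAl.
- by rewrite -lpa_mulE -lpa_mulA IHy.
Qed.

(* Only a [pzRingType]: L_K(E) = 0 if E has no vertices.  For this reason it is
   not an [algType], which is nontrivial by definition. *)
HB.instance Definition _ := GRing.Zmodule_isPzRing.Build lpa
  lpa_mulA lpa_mul1 lpa_mulr1 lpa_mulDl lpa_mulDr.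

(* The elements of L_K(E) given by a path p and by p^*; the factor [lpa_vert w]
   only matters for paths of length 0. *)
Definition lpa_path (w : vert E) (p : seq (edge E)) : lpa :=
  lpa_vert w * \prod_(e <- p) lpa_edge e.

Definition lpa_path_star (w : vert E) (p : seq (edge E)) : lpa :=
  (\prod_(e <- rev p) lpa_ghost e) * lpa_vert w.

End Presentation.

Definition span (K : fieldType) (V : lmodType K) (A : set V) : set V :=
  [set x | exists2 s : seq (K * V), (forall y, y \in s -> A y.2) &
             x = \sum_(y <- s) y.1 *: y.2].

Definition lpa_component (E : digraph) (K : fieldType) (n : int) :
    set (lpa E K) :=
  span [set x : lpa E K |
         exists (w : vert E) (p : seq (edge E)) (w' : vert E) (q : seq (edge E)),
           [/\ is_path w p, is_path w' q,
               (size p)%:Z - (size q)%:Z = n &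
               x = lpa_path K w p * lpa_path_star K w' q]].


(* [C g] is the [g]-component.  The grading group is abelian and written
   additively. *)
Section Graded.
Variables (G : zmodType) (R : pzRingType) (C : G -> set R).

Definition invertible (u : R) := exists v : R, u * v = 1 /\ v * u = 1.

(* AB is the additive subgroup generated by the products ab. *)
Definition set_mul (A B : set R) : set R :=
  [set x | exists2 s : seq (R * R), (forall y, y \in s -> A y.1 /\ B y.2) &
             x = \sum_(y <- s) y.1 * y.2].

Definition strongly_graded := forall g d : G, set_mul (C g) (C d) = C (g + d).

Definition crossed_product := forall g : G, exists2 u : R, C g u & invertible u.

Definition graded_unit_regular :=
  forall (g : G) (a : R), C g a -> a <> 0 ->
    exists2 u : R, C (- g) u /\ invertible u & a = a * u * a.

End Graded.

(* Main.v *)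
Require Import Defs.
From mathcomp Require Import all_boot all_algebra.
From mathcomp Require Import boolp classical_sets functions cardinality.
From mathcomp Require Import zify.

Set Implicit Arguments.
Unset Strict Implicit.
Unset Printing Implicit Defensive.

Import GRing.Theory.
Local Open Scope ring_scope.

(** The graph and the algebra communicate through the numbers [num n v] of paths
    of length [n] that end in the vertex [v].  For a finite graph without sinks,
    each of the three conditions amounts to the statement that [num n v] does not
    depend on [n] once [n] is large ([stable_from]).

    The algebra.  The relations at the vertices prolong the paths in a monomial
    [p q^*], so that for all large [m] and [n] an element of degree [m - n] is a
    combination of the [p q^*] with [p] of length [m], [q] of length [n] and a
    common end [v] ([component_Phi]).  These monomials multiply like matrix
    units, and they are linearly independent because vertices are nonzero.  So an
    element of degree [m - n] is a family, indexed by [v], of matrices of size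
    [num m v] by [num n v], and products are matrix products ([PhiM],
    [Phi_inj]).  A unit of degree 1 has a homogeneous inverse, hence it is given
    by invertible matrices of size [num n.+1 v] by [num n v], and these must be
    square.  Conversely, if the numbers are stable then homogeneous elements are
    families of square matrices: identity matrices give units of every degree,
    from which the grading is strong, and graded unit-regularity is the
    unit-regularity of matrix algebras over a field, which follows from Gaussian
    elimination ([unit_regular_mx]).  That a unit of degree 1 forces the graph to
    be finite and without sinks is elementary: some generator would annihilate
    it otherwise.

    The graph.  Summing the numbers of paths over all ends, stability says that a
    vertex [v] with [num n v > 0] emits only one edge, so no cycle has an exit
    ([stable_no_exit]).  In a graph without exits, a path to a vertex [v] of a
    cycle [c] consists of a path that visits [v] only at its end, which is the
    same as a path to [v] that does not contain [c], and of a whole number of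
    laps.  So for large [n] the number [num n v] counts the paths of Condition
    (EDL) whose length is congruent to [n] modulo the length of [c]
    ([arrivals_count]), and (EDL) says that this does not depend on the residue.
    At a vertex outside of the cycles [num n v] is eventually 0, since long paths
    run into a cycle and cannot leave it.

    Finally, a strongly graded nonzero algebra has nonzero elements of each
    degree, and graded unit-regularity attaches a unit to any of them.

    Two facts about the presented algebra need representations of it: vertices
    are nonzero ([boundary_rep]), and the homogeneous components are
    independent ([gr_rep]). *)

(** * The generators and relations of a Leavitt path algebra *)

Section Relations.
Variables (E : digraph) (K : fieldType).
Local Notation L := (lpa E K).
Local Notation V := (lpa_vert K).
Local Notation A := (lpa_edge K).
Local Notation B := (lpa_ghost K).
Implicit Types (k : K) (a b : L) (v w : vert E) (e f : edge E).

Lemma lpa_pi_add (x y : lpa_term E K) :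
  lpa_pi (tAdd x y) = lpa_pi x + lpa_pi y.
Proof. by rewrite -lpa_addE. Qed.

Lemma lpa_pi_scale k (x : lpa_term E K) : lpa_pi (tScale k x) = k *: lpa_pi x.
Proof. by rewrite -lpa_scaleE. Qed.

Lemma lpa_pi_mul (x y : lpa_term E K) :
  lpa_pi (tMul x y) = lpa_pi x * lpa_pi y.
Proof. by rewrite -lpa_mulE. Qed.

Lemma lpa_scalerAl k a b : k *: (a * b) = (k *: a) * b.
Proof.
elim/lpa_ind: a => x; elim/lpa_ind: b => y.
rewrite -lpa_pi_mul -!lpa_pi_scale -lpa_pi_mul.
by apply/lpa_piP/eqv_scaleAl.
Qed.

Lemma lpa_scalerAr k a b : k *: (a * b) = a * (k *: b).
Proof.
elim/lpa_ind: a => x; elim/lpa_ind: b => y.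
rewrite -lpa_pi_mul -!lpa_pi_scale -lpa_pi_mul.
by apply/lpa_piP/eqv_scaleAr.
Qed.

Lemma lpa_oneE : 1 = \sum_v V v :> L. Proof. by []. Qed.

Lemma vertM v w : V v * V w = if v == w then V v else 0.
Proof.
rewrite -lpa_pi_mul; case: eqVneq => [<-|/eqP vw].
  by apply/lpa_piP/eqv_vert.
by apply/lpa_piP/eqv_vert_orth.
Qed.

Lemma vert_edge v e : V v * A e = if v == src e then A e else 0.
Proof.
have E1 : V (src e) * A e = A e.
  by rewrite -lpa_pi_mul; apply/lpa_piP/eqv_src_edge.
by rewrite -E1 mulrA vertM; case: eqVneq => [->//|_]; rewrite mul0r.
Qed.

Lemma edge_vert e v : A e * V v = if rng e == v then A e else 0.
Proof.
have E1 : A e * V (rng e) = A e.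
  by rewrite -lpa_pi_mul; apply/lpa_piP/eqv_edge_rng.
by rewrite -E1 -mulrA vertM; case: eqVneq => [->//|_]; rewrite mulr0.
Qed.

Lemma vert_ghost v e : V v * B e = if v == rng e then B e else 0.
Proof.
have E1 : V (rng e) * B e = B e.
  by rewrite -lpa_pi_mul; apply/lpa_piP/eqv_rng_ghost.
by rewrite -E1 mulrA vertM; case: eqVneq => [->//|_]; rewrite mul0r.
Qed.

Lemma ghost_vert e v : B e * V v = if src e == v then B e else 0.
Proof.
have E1 : B e * V (src e) = B e.
  by rewrite -lpa_pi_mul; apply/lpa_piP/eqv_ghost_src.
by rewrite -E1 -mulrA vertM; case: eqVneq => [->//|_]; rewrite mulr0.
Qed.

Lemma ghost_edge e f : B e * A f = if e == f then V (rng e) else 0.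
Proof.
rewrite -lpa_pi_mul; case: eqVneq => [<-|/eqP ef].
  by apply/lpa_piP/eqv_ghost_edge.
by apply/lpa_piP/eqv_ghost_orth.
Qed.

Lemma vert_regular v (s : seq (edge E)) :
    s <> [::] -> uniq s -> (forall e, (e \in s) = (src e == v)) ->
  V v = \sum_(e <- s) A e * B e.
Proof.
move=> s0 us sv; have /lpa_piP := eqv_regular K s0 us sv.
rewrite /lpa_vert => ->.
elim: (s) => [|e r IH]; first by rewrite big_nil.
by rewrite big_cons -IH lpa_pi_add lpa_pi_mul.
Qed.

End Relations.

(** * Representations of a Leavitt path algebra *)

Section Action.
Variables (E : digraph) (K : fieldType) (M : lmodType K).
Variables (V : vert E -> M -> M) (A B : edge E -> M -> M).

(** Such operators extend to an action [lpa_act] of the whole algebra; this is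
    the universal property of the presentation. *)
Record lpa_rep : Prop := LpaRep {
  rep_vert_lin v : linear (V v);
  rep_edge_lin e : linear (A e);
  rep_ghost_lin e : linear (B e);
  rep_vert v x : V v (V v x) = V v x;
  rep_vert_orth v w x : v <> w -> V v (V w x) = 0;
  rep_src_edge e x : V (src e) (A e x) = A e x;
  rep_edge_rng e x : A e (V (rng e) x) = A e x;
  rep_rng_ghost e x : V (rng e) (B e x) = B e x;
  rep_ghost_src e x : B e (V (src e) x) = B e x;
  rep_ghost_edge e x : B e (A e x) = V (rng e) x;
  rep_ghost_orth e f x : e <> f -> B e (A f x) = 0;
  rep_regular v s x : s <> [::] -> uniq s ->
    (forall e, (e \in s) = (src e == v)) ->
    V v x = \sum_(e <- s) A e (B e x) }.

Fixpoint act (t : lpa_term E K) (x : M) : M :=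
  match t with
  | tVert v => V v x
  | tEdge e => A e x
  | tGhost e => B e x
  | tZero => 0
  | tOpp t => - act t x
  | tAdd t u => act t x + act u x
  | tScale k t => k *: act t x
  | tMul t u => act t (act u x)
  end.

Hypothesis rep : lpa_rep.

Lemma act_linear t : linear (act t).
Proof.
elim: t => [v|e|e||t IH|t IHt u IHu|k t IH|t IHt u IHu] c x y /=.
- exact: rep_vert_lin.
- exact: rep_edge_lin.
- exact: rep_ghost_lin.
- by rewrite scaler0 addr0.
- by rewrite IH opprD scalerN.
- by rewrite IHt IHu scalerDr addrACA.
- by rewrite IH scalerDr !scalerA mulrC.
- by rewrite IHu IHt.
Qed.

Lemma act_add t x y : act t (x + y) = act t x + act t y.
Proof. by rewrite -[x]scale1r act_linear !scale1r. Qed.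

Lemma act_scale t k x : act t (k *: x) = k *: act t x.
Proof.
have act0 : act t 0 = 0.
  by apply: (addrI (act t 0)); rewrite -act_add !addr0.
by rewrite -[k *: x]addr0 act_linear act0 addr0.
Qed.

Lemma act_eqv t u : lpa_eqv t u -> act t =1 act u.
Proof.
elim=> {t u} /=.
- by [].
- by move=> t u _ IH x; rewrite IH.
- by move=> t u v _ IH1 _ IH2 x; rewrite IH1 IH2.
- by move=> t u _ IH x; rewrite IH.
- by move=> t u v w _ IH1 _ IH2 x; rewrite IH1 IH2.
- by move=> k t u _ IH x; rewrite IH.
- by move=> t u v w _ IH1 _ IH2 x; rewrite IH1 IH2.
- by move=> t u v x; rewrite addrA.
- by move=> t u x; rewrite addrC.
- by move=> t x; rewrite add0r.
- by move=> t x; rewrite addNr.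
- by move=> k l t x; rewrite scalerA.
- by move=> t x; rewrite scale1r.
- by move=> k t u x; rewrite scalerDr.
- by move=> k l t x; rewrite scalerDl.
- by [].
- by [].
- by move=> t u v x; rewrite act_add.
- by [].
- by move=> k t u x; rewrite act_scale.
- exact: rep_vert.
- by move=> v w vw x; exact: rep_vert_orth.
- exact: rep_src_edge.
- exact: rep_edge_rng.
- exact: rep_rng_ghost.
- exact: rep_ghost_src.
- exact: rep_ghost_edge.
- by move=> e f ef x; exact: rep_ghost_orth.
- move=> v s s0 us sv x; rewrite (rep_regular rep x s0 us sv).
  elim: (s) => [|e r IH]; first by rewrite big_nil.
  by rewrite big_cons IH.
Qed.

Definition lpa_act (a : lpa E K) : M -> M := act (repr a).

Lemma lpa_act_pi t x : lpa_act (lpa_pi t) x = act t x.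
Proof. exact/act_eqv/lpa_repr. Qed.

Lemma lpa_act0 x : lpa_act 0 x = 0.
Proof. exact: lpa_act_pi. Qed.

Lemma lpa_actD a b x : lpa_act (a + b) x = lpa_act a x + lpa_act b x.
Proof.
elim/lpa_ind: a => t; elim/lpa_ind: b => u.
by rewrite -lpa_pi_add !lpa_act_pi.
Qed.

Lemma lpa_actZ k a x : lpa_act (k *: a) x = k *: lpa_act a x.
Proof. by elim/lpa_ind: a => t; rewrite -lpa_pi_scale !lpa_act_pi. Qed.

Lemma lpa_actM a b x : lpa_act (a * b) x = lpa_act a (lpa_act b x).
Proof.
elim/lpa_ind: a => t; elim/lpa_ind: b => u.
by rewrite -lpa_pi_mul !lpa_act_pi.
Qed.

End Action.

(** * Vertices are nonzero *)

Section BoundaryPaths.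
Variables (E : digraph) (K : fieldType).
Implicit Types (v w : vert E) (e f : edge E) (o : nat -> option (edge E)).

Definition regular v := exists2 s : seq (edge E), s <> [::] &
  forall e, (e \in s) = (src e == v).

Definition ocons e o : nat -> option (edge E) :=
  fun n => if n is n'.+1 then o n' else Some e.

Definition otail o : nat -> option (edge E) := fun n => o n.+1.

Fixpoint legal_upto n v o : Prop :=
  if n is n'.+1 then
    if o 0 is Some e then src e = v /\ legal_upto n' (rng e) (otail o)
    else ~ regular v
  else True.

(** The infinite paths from [v], together with the finite ones that end in a
    vertex that is not regular.  A finite path is followed by [None] and then by
    arbitrary entries; these spurious points are harmless, because no relation
    expresses a vertex that is not regular by the edges it emits. *)
Definition legal v o := forall n, legal_upto n v o.

Lemma legal_cons v e o : legal v (ocons e o) <-> src e = v /\ legal (rng e) o.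
Proof.
split=> [lo|[<- lo]].
  by split=> [|n]; [have [] := lo 1 | have [] := lo n.+1].
by case=> [|n] //; split=> //; exact: (lo n).
Qed.

Lemma legal_regular v o : regular v -> legal v o ->
  exists2 e, o 0 = Some e & src e = v.
Proof.
by move=> rv /(_ 1) /=; case: (o 0) => [e [ev _]|//]; exists e.
Qed.

Lemma ocons_tail e o : o 0 = Some e -> ocons e (otail o) = o.
Proof. by move=> oe; apply: funext => -[|n] /=. Qed.

(** Follow a chosen edge out of each vertex as long as there is one. *)
Lemma legal_exists v : exists o, legal v o.
Proof.
pose next v := if pselect (exists e, src e == v) is left ex
  then Some (xchoose ex) else None.
pose fix walk v n : option (edge E) := match n, next v with
  | 0, _ => next v
  | n'.+1, Some e => walk (rng e) n'
  | _, None => None end.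
exists (walk v) => n; elim: n v => //= n IH v.
case nv : (next v) => [e|].
  split.
    move: nv; rewrite /next; case: pselect => // ex [<-].
    exact/eqP/(xchooseP ex).
  have -> // : otail (walk v) = walk (rng e).
  by apply: funext => i; rewrite /otail /= nv.
move=> [s s0 sv]; move: nv; rewrite /next; case: pselect => // nex _.
case: s s0 sv => // e s _ /(_ e); rewrite inE eqxx /= => /esym ev.
by apply: nex; exists e.
Qed.

Let X : Type := vert E * (nat -> option (edge E)).
Let M := (X -> K^o : lmodType K).

Definition bvert v (f : M) : M := fun x =>
  if `[< x.1 = v /\ legal x.1 x.2 >] then f x else 0.

Definition bedge e (f : M) : M := fun x =>
  if `[< [/\ x.1 = src e, legal x.1 x.2 & x.2 0 = Some e] >]
  then f (rng e, otail x.2) else 0.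

Definition bghost e (f : M) : M := fun x =>
  if `[< x.1 = rng e /\ legal x.1 x.2 >] then f (src e, ocons e x.2) else 0.

(** Functions on the boundary paths: an edge prepends itself, its ghost removes
    it.  As functions are pulled back along partial injections, no finiteness of
    the support is involved. *)
Lemma boundary_rep : lpa_rep bvert bedge bghost.
Proof.
have lin (P : X -> bool) (h : X -> X) :
    linear (fun f : M => (fun x => if P x then f (h x) else 0) : M).
  move=> k f g; apply: funext => x; rewrite !fctE /=.
  by case: ifP => // _; rewrite scaler0 addr0.
split.
- by move=> v; exact: lin.
- by move=> e; exact: lin.
- by move=> e; exact: lin.
- move=> v f; apply: funext => x; rewrite /bvert.
  by case: (asboolP (x.1 = v /\ legal x.1 x.2)).
- move=> v w f vw; apply: funext => x; rewrite /bvert.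
  case: (asboolP (x.1 = v /\ _)) => // -[xv _].
  by case: (asboolP (x.1 = w /\ _)) => // -[xw _]; case: vw; rewrite -xv -xw.
- move=> e f; apply: funext => x; rewrite /bvert /bedge.
  case: (asboolP (x.1 = src e /\ _)) => // nx.
  by case: asboolP => // -[x1 x2 _]; case: nx.
- move=> e f; apply: funext => -[v o]; rewrite /bvert /bedge /=.
  case: asboolP => // -[-> lo oe]; rewrite asboolT //; split=> //.
  by move: lo; rewrite -(ocons_tail oe) => /legal_cons [].
- move=> e f; apply: funext => x; rewrite /bvert /bghost.
  by case: (asboolP (x.1 = rng e /\ legal x.1 x.2)).
- move=> e f; apply: funext => -[v o]; rewrite /bvert /bghost /=.
  case: asboolP => // -[-> lo]; rewrite asboolT //; split=> //.
  exact/legal_cons.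
- move=> e f; apply: funext => -[v o]; rewrite /bvert /bghost /bedge /=.
  case: asboolP => // -[-> lo]; rewrite asboolT //; split=> //.
  exact/legal_cons.
- move=> e f g ef; apply: funext => -[v o]; rewrite /bghost /bedge /=.
  case: asboolP => // -[-> lo]; rewrite asboolF // => -[_ _ [fe]].
  exact/ef.
- move=> v s f s0 us sv; apply: funext => -[w o]; rewrite fct_sumE /=.
  rewrite /bvert /=; case: asboolP => [[-> lo]|nlo].
    have rv : regular v by exists s.
    have [e oe ev] := legal_regular rv lo.
    have es : e \in s by rewrite sv ev.
    rewrite (bigD1_seq e) //= big1 => [|g /eqP ge].
      rewrite addr0 /bedge /bghost /= !asboolT ?ev ?ocons_tail //.
      split=> //; move: lo; rewrite -(ocons_tail oe).
      by move/legal_cons => [].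
    rewrite /bedge /= asboolF // => -[_ _]; rewrite oe => -[eg].
    exact/ge.
  rewrite big1_seq // => e /andP[_]; rewrite sv => /eqP ev.
  rewrite /bedge /= asboolF // => -[we lo _]; apply: nlo.
  by rewrite we ev; split=> //; rewrite -ev -we.
Qed.

Lemma lpa_vert_neq0 v : lpa_vert K v != 0.
Proof.
have [o lo] := legal_exists v; apply/eqP => v0.
have := lpa_act0 boundary_rep (fun=> 1).
rewrite -v0 (lpa_act_pi boundary_rep) => /(congr1 (@^~ (v, o))).
by rewrite /= /bvert asboolT //= => /eqP; rewrite oner_eq0.
Qed.

End BoundaryPaths.

(** * Paths as elements of the algebra *)

Section PathElements.
Variables (E : digraph) (K : fieldType).
Local Notation L := (lpa E K).
Local Notation V := (lpa_vert K).
Local Notation A := (lpa_edge K).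
Local Notation B := (lpa_ghost K).
Local Notation P := (lpa_path K).
Local Notation S := (lpa_path_star K).
Implicit Types (v w : vert E) (e f : edge E) (p q : seq (edge E)).

Lemma is_path_rcons w p e :
  is_path w (rcons p e) = is_path w p && (src e == path_end w p).
Proof. by elim: p w => [|f p IH] w //=; rewrite ?andbT // IH andbA. Qed.

Lemma path_end_rcons w p e : path_end w (rcons p e) = rng e.
Proof. by rewrite /path_end map_rcons last_rcons. Qed.

Lemma is_path_cat w p q :
  is_path w (p ++ q) = is_path w p && is_path (path_end w p) q.
Proof. by elim: p w => [|f p IH] w //=; rewrite IH andbA. Qed.

Lemma path_end_cat w p q : path_end w (p ++ q) = path_end (path_end w p) q.
Proof. by rewrite /path_end map_cat last_cat. Qed.

Lemma lpa_path_nil w : P w [::] = V w.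
Proof. by rewrite /lpa_path big_nil mulr1. Qed.

Lemma lpa_path_star_nil w : S w [::] = V w.
Proof. by rewrite /lpa_path_star big_nil mul1r. Qed.

Lemma vert_lpa_path w p : V w * P w p = P w p.
Proof. by rewrite /lpa_path mulrA vertM eqxx. Qed.

Lemma lpa_path_cons e p : P (src e) (e :: p) = A e * P (rng e) p.
Proof.
rewrite /lpa_path big_cons !mulrA vert_edge eqxx.
by rewrite edge_vert eqxx.
Qed.

Lemma lpa_path_rcons w p e : P w (rcons p e) = P w p * A e.
Proof. by rewrite /lpa_path big_rcons mulrA. Qed.

Lemma lpa_path_star_cons e p : S (src e) (e :: p) = S (rng e) p * B e.
Proof.
rewrite /lpa_path_star rev_cons big_rcons -!mulrA ghost_vert eqxx.
by rewrite vert_ghost eqxx.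
Qed.

Lemma lpa_path_star_rcons w p e : S w (rcons p e) = B e * S w p.
Proof. by rewrite /lpa_path_star rev_rcons big_cons mulrA. Qed.

Lemma lpa_path_vert w p v : is_path w p ->
  P w p * V v = if path_end w p == v then P w p else 0.
Proof.
elim/last_ind: p => [_|p e _ _].
  by rewrite lpa_path_nil vertM.
rewrite lpa_path_rcons path_end_rcons -mulrA edge_vert.
by case: eqP => // _; rewrite mulr0.
Qed.

Lemma vert_lpa_path_star w p v : is_path w p ->
  V v * S w p = if path_end w p == v then S w p else 0.
Proof.
elim/last_ind: p => [_|p e _ _].
  by rewrite lpa_path_star_nil vertM eq_sym; case: eqVneq => [->|].
rewrite lpa_path_star_rcons path_end_rcons mulrA vert_ghost eq_sym.
by case: eqP => // _; rewrite mul0r.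
Qed.

Lemma star_path w p w' q : size p = size q -> is_path w p -> is_path w' q ->
  S w p * P w' q =
  if (w == w') && (p == q) then V (path_end w p) else 0.
Proof.
elim: p q w w' => [|e p IH] [|f q] //= w w'.
  by rewrite lpa_path_nil lpa_path_star_nil vertM andbT.
case=> pq /andP[/eqP<- pp] /andP[/eqP<- qq].
rewrite lpa_path_star_cons lpa_path_cons -mulrA [B e * _]mulrA ghost_edge.
rewrite eqseq_cons; case: (eqVneq e f) qq => [<- qq|ef _]; last first.
  by rewrite andbF mul0r mulr0.
rewrite vert_lpa_path IH //. 
by rewrite !eqxx.
Qed.

(** * Homogeneous components *)

Local Notation span := Defs.span.

Lemma span_mem (M : lmodType K) (X : set M) x : X x -> span X x.
Proof.
move=> Xx; exists [:: (1, x)]; last by rewrite big_seq1 scale1r.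
by move=> y; rewrite inE => /eqP ->.
Qed.

Lemma span0 (M : lmodType K) (X : set M) : span X 0.
Proof. by exists [::]; rewrite ?big_nil. Qed.

Lemma spanD (M : lmodType K) (X : set M) x y :
  span X x -> span X y -> span X (x + y).
Proof.
move=> [s sX ->] [t tX ->]; exists (s ++ t); last by rewrite big_cat.
by move=> z; rewrite mem_cat => /orP[/sX|/tX].
Qed.

Lemma spanZ (M : lmodType K) (X : set M) k x : span X x -> span X (k *: x).
Proof.
move=> [s sX ->]; exists [seq (k * y.1, y.2) | y <- s].
  by move=> _ /mapP[y ys ->] /=; exact: sX.
by rewrite big_map scaler_sumr; apply: eq_bigr => y _; rewrite scalerA.
Qed.

Lemma span_ind (M : lmodType K) (X : set M) (Q : M -> Prop) :
    Q 0 -> (forall x y, Q x -> Q y -> Q (x + y)) ->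
    (forall k x, Q x -> Q (k *: x)) -> (forall x, X x -> Q x) ->
  forall x, span X x -> Q x.
Proof.
move=> Q0 QD QZ QX x [s sX ->].
by rewrite big_seq; apply: (big_ind Q) => // y /sX Xy; exact/QZ/QX.
Qed.

Local Notation C := (@lpa_component E K).

Lemma component_monomial w p w' q (n : int) : is_path w p -> is_path w' q ->
  (size p)%:Z - (size q)%:Z = n -> C n (P w p * S w' q).
Proof. by move=> wp wq pq; apply: span_mem; exists w, p, w', q. Qed.

Lemma component_sum (I : Type) (r : seq I) (F : I -> L) n :
  (forall i, C n (F i)) -> C n (\sum_(i <- r) F i).
Proof.
move=> CF; apply: (big_ind (C n)) => //; first exact: span0.
exact: spanD.
Qed.

Lemma lpa_component_ind n (Q : L -> Prop) :
    Q 0 -> (forall x y, Q x -> Q y -> Q (x + y)) ->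
    (forall k x, Q x -> Q (k *: x)) ->
    (forall w p w' q, is_path w p -> is_path w' q ->
      (size p)%:Z - (size q)%:Z = n -> Q (P w p * S w' q)) ->
  forall x, C n x -> Q x.
Proof.
move=> Q0 QD QZ Qm; apply: span_ind => // _ [w [p [w' [q [wp wq pq ->]]]]].
exact: Qm.
Qed.

(** A monomial [p q^*] is a product of generators whose degrees add up to its
    own. *)
Lemma homogeneous_ind (Q : int -> L -> Prop) :
    (forall n, Q n 0) -> (forall n x y, Q n x -> Q n y -> Q n (x + y)) ->
    (forall n k x, Q n x -> Q n (k *: x)) ->
    (forall m n x y, Q m x -> Q n y -> Q (m + n) (x * y)) ->
    (forall v, Q 0 (V v)) -> (forall e, Q 1 (A e)) ->
    (forall e, Q (-1) (B e)) ->
  forall n x, C n x -> Q n x.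
Proof.
move=> Q0 QD QZ QM QV QA QB n x; apply: lpa_component_ind => //.
- exact: QD.
- exact: QZ.
move=> w p w' q _ _ <-; apply: (QM); last first.
  elim/last_ind: q => [|q e IH]; first by rewrite lpa_path_star_nil.
  rewrite lpa_path_star_rcons size_rcons.
  have -> : - (size q).+1%:Z = -1 + - (size q)%:Z by lia.
  exact: QM.
elim/last_ind: p => [|p e IH]; first by rewrite lpa_path_nil.
rewrite lpa_path_rcons size_rcons.
have -> : (size p).+1%:Z = (size p)%:Z + 1 by lia.
exact: QM.
Qed.

Lemma component_lmul_monomials d a :
    (forall w p w' q, is_path w p -> is_path w' q ->
      C (d + ((size p)%:Z - (size q)%:Z)) (a * (P w p * S w' q))) ->
  forall n x, C n x -> C (d + n) (a * x).
Proof.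
move=> Cm n; apply: lpa_component_ind => [|x y Cx Cy|k x Cx|w p w' q wp wq <-].
- by rewrite mulr0; exact: span0.
- by rewrite mulrDr; exact: spanD.
- by rewrite -lpa_scalerAr; exact: spanZ.
- exact: Cm.
Qed.

(** It is enough to multiply a monomial [p q^*] by a generator on the left.  A
    ghost either cancels the first edge of [p] or, if [p] has length 0, prolongs
    [q]; the result is again a monomial, or 0. *)
Lemma componentM d n a x : C d a -> C n x -> C (d + n) (a * x).
Proof.
move=> Cda; move: n x.
move: d a Cda; apply: homogeneous_ind.
- by move=> d n x _; rewrite mul0r; exact: span0.
- move=> d a b Ca Cb n x Cx; rewrite mulrDl.
  by apply: spanD; [exact: Ca | exact: Cb].
- by move=> d k a Ca n x Cx; rewrite -lpa_scalerAl; apply: spanZ; exact: Ca.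
- by move=> d d' a b Ca Cb n x Cx; rewrite -mulrA -addrA; exact/Ca/Cb.
- move=> v; apply: component_lmul_monomials => w p w' q wp wq.
  rewrite add0r mulrA [in X in C _ (X * _)]/lpa_path mulrA vertM.
  case: eqVneq => [->|_]; last by rewrite !mul0r; exact: span0.
  exact: component_monomial.
- move=> e; apply: component_lmul_monomials => w p w' q wp wq.
  have [ew|ew] := eqVneq (rng e) w.
    rewrite -ew mulrA -lpa_path_cons; apply: component_monomial => //=.
      by rewrite eqxx ew.
    lia.
  rewrite /lpa_path !mulrA edge_vert (negbTE ew) !mul0r.
  exact: span0.
- move=> e; apply: component_lmul_monomials => w [|f p] w' q wp wq.
    rewrite lpa_path_nil vert_lpa_path_star //.
    case: eqP => [qw|_]; last by rewrite mulr0; exact: span0.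
    rewrite -lpa_path_star_rcons; have [ew|ew] := eqVneq (src e) w.
      have qe : is_path w' (rcons q e) by rewrite is_path_rcons wq qw ew eqxx.
      have <- : V (rng e) * S w' (rcons q e) = S w' (rcons q e).
        by rewrite vert_lpa_path_star // path_end_rcons eqxx.
      rewrite -lpa_path_nil; apply: component_monomial => //.
      by rewrite size_rcons /=; lia.
    have <- : B e * (V w * S w' q) = S w' (rcons q e).
      by rewrite vert_lpa_path_star // qw eqxx lpa_path_star_rcons.
    by rewrite mulrA ghost_vert (negbTE ew) mul0r; exact: span0.
  have /andP[/eqP<- fp] := wp.
  rewrite lpa_path_cons -(mulrA (A f)) (mulrA (B e)) ghost_edge.
  case: eqVneq => [->|_]; last by rewrite mul0r; exact: span0.
  rewrite mulrA vert_lpa_path; apply: component_monomial => //=.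
  lia.
Qed.

Lemma component_vert v : C 0 (V v).
Proof.
have -> : V v = P v [::] * S v [::].
  by rewrite lpa_path_nil lpa_path_star_nil vertM eqxx.
exact: component_monomial.
Qed.

Lemma component_edge e : C 1 (A e).
Proof.
have -> : A e = P (src e) [:: e] * S (rng e) [::].
  by rewrite lpa_path_cons lpa_path_nil lpa_path_star_nil -mulrA vertM eqxx
    edge_vert eqxx.
by apply: component_monomial => //=; rewrite eqxx.
Qed.

Lemma component_ghost e : C (-1) (B e).
Proof.
have -> : B e = P (rng e) [::] * S (src e) [:: e].
  by rewrite lpa_path_star_cons lpa_path_nil lpa_path_star_nil mulrA vertM eqxx
    vert_ghost eqxx.
by apply: component_monomial => //=; rewrite eqxx.
Qed.

Lemma component1 : C 0 1.
Proof.
by rewrite lpa_oneE; apply: component_sum => v; exact: component_vert.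
Qed.

End PathElements.

(** * The inverse of a homogeneous unit is homogeneous *)

Section Grading.
Variables (E : digraph) (K : fieldType).
Local Notation L := (lpa E K).
Local Notation C := (@lpa_component E K).

Definition gr_vert (v : vert E) (f : int -> L) : int -> L :=
  fun j => lpa_vert K v * f j.
Definition gr_edge (e : edge E) (f : int -> L) : int -> L :=
  fun j => lpa_edge K e * f (j - 1).
Definition gr_ghost (e : edge E) (f : int -> L) : int -> L :=
  fun j => lpa_ghost K e * f (j + 1).

(** A function [f : int -> L] stands for the Laurent series with coefficients
    [f j], on which an element of degree [n] acts after multiplication by the
    [n]-th power of the variable.  That this is well defined says that the
    relations are homogeneous. *)
Lemma gr_rep : lpa_rep (M := int -> L) gr_vert gr_edge gr_ghost.
Proof.
have lin (a : L) (h : int -> int) :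
    linear (fun f : int -> L => (fun j => a * f (h j)) : int -> L).
  move=> k f g; apply: funext => j; rewrite !fctE /=.
  by rewrite mulrDr lpa_scalerAr.
split; rewrite /gr_vert /gr_edge /gr_ghost.
- by move=> v; exact: lin.
- by move=> e; exact: lin.
- by move=> e; exact: lin.
- by move=> v f; apply: funext => j; rewrite mulrA vertM eqxx.
- move=> v w f /eqP/negbTE vw; apply: funext => j.
  by rewrite mulrA vertM vw mul0r.
- by move=> e f; apply: funext => j; rewrite mulrA vert_edge eqxx.
- by move=> e f; apply: funext => j; rewrite mulrA edge_vert eqxx.
- by move=> e f; apply: funext => j; rewrite mulrA vert_ghost eqxx.
- by move=> e f; apply: funext => j; rewrite mulrA ghost_vert eqxx.
- move=> e f; apply: funext => j.
  by rewrite addrK mulrA ghost_edge eqxx.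
- move=> e g f /eqP/negbTE eg; apply: funext => j.
  by rewrite mulrA ghost_edge eg mul0r.
- move=> v s f s0 us sv; apply: funext => j.
  rewrite fct_sumE (vert_regular K s0 us sv) mulr_suml.
  by apply: eq_bigr => e _; rewrite subrK mulrA.
Qed.

(** The value at [n] of [gr_act a f], for the [f] concentrated in degree 0 with
    value 1, is the component of [a] of degree [n]. *)
Definition gr_act : L -> (int -> L) -> int -> L :=
  lpa_act gr_vert gr_edge gr_ghost.

Lemma gr_act_homogeneous n a : C n a ->
  forall f j, gr_act a f j = a * f (j - n).
Proof.
move: n a; apply: homogeneous_ind.
- by move=> n f j; rewrite mul0r /gr_act (lpa_act0 gr_rep).
- move=> n a b IHa IHb f j.
  by rewrite /gr_act (lpa_actD gr_rep) mulrDl -IHa -IHb.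
- by move=> n k a IH f j; rewrite /gr_act (lpa_actZ gr_rep) -lpa_scalerAl -IH.
- move=> m n a b IHa IHb f j.
  rewrite /gr_act (lpa_actM gr_rep) -/(gr_act a _) -/(gr_act b _) IHa IHb mulrA.
  congr (_ * f _); lia.
- by move=> v f j; rewrite subr0 /gr_act (lpa_act_pi gr_rep).
- by move=> e f j; rewrite /gr_act (lpa_act_pi gr_rep).
- by move=> e f j; rewrite opprK /gr_act (lpa_act_pi gr_rep).
Qed.

Lemma gr_act_component a f :
  (forall j, C j (f j)) -> forall j, C j (gr_act a f j).
Proof.
elim/lpa_ind: a => t Cf j; rewrite /gr_act (lpa_act_pi gr_rep).
elim: t f Cf j => [v|e|e||t IH|t IHt u IHu|k t IH|t IHt u IHu] f Cf j /=.
- by have := componentM (component_vert K v) (Cf j); rewrite add0r.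
- by have := componentM (component_edge K e) (Cf (j - 1)); rewrite addrC subrK.
- by have := componentM (component_ghost K e) (Cf (j + 1)); rewrite addrC addrK.
- exact: span0.
- by rewrite -scaleN1r; apply: spanZ; exact: IH.
- by apply: spanD; [exact: IHt | exact: IHu].
- by apply: spanZ; exact: IH.
- by apply: IHt; exact: IHu.
Qed.

(** The coefficient of degree [n] is a projection to the component of degree
    [n]; if [u] has degree [n] and the inverse [w] then only the component of [w]
    of degree [- n] can contribute to [u * w], so that it is a right inverse of
    [u] as well. *)
Lemma homogeneous_inverse n u w :
  C n u -> u * w = 1 -> w * u = 1 -> C (- n) w.
Proof.
move=> Cu uw wu.
pose delta (j : int) : L := if j == 0 then 1 else 0.
pose w' := gr_act w delta (- n).
have Cw' : C (- n) w'.
  apply: gr_act_component => j; rewrite /delta.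
  by case: eqP => [->|_]; [exact: component1 | exact: span0].
(* A right inverse of [u] is equal to its inverse [w]. *)
suff uw' : u * w' = 1 by rewrite -[w]mulr1 -uw' mulrA wu mul1r.
have := gr_act_homogeneous Cu (gr_act w delta) 0.
rewrite sub0r => <-; rewrite /gr_act -(lpa_actM gr_rep) uw -/(gr_act 1 _).
by rewrite (gr_act_homogeneous (component1 E K)) mul1r.
Qed.

End Grading.

(** * Units of degree one force finiteness and exclude sinks *)

Section UnitOfDegreeOne.
Variables (E : digraph) (K : fieldType).
Local Notation L := (lpa E K).
Local Notation C := (@lpa_component E K).
Variables u u' : L.
Hypotheses (Cu : C 1 u) (uu' : u * u' = 1).

Lemma unit_lmul_neq0 a : a != 0 -> a * u != 0.
Proof.
by apply: contraNneq => au; rewrite -[a]mulr1 -uu' mulrA au mul0r.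
Qed.

(** Only finitely many edges can be the first edge of a path occurring in [u],
    and the ghosts of all others annihilate [u]. *)
Lemma unit_degree1_finite : finite_graph E.
Proof.
suff [s Hs] : exists s : seq (edge E),
    forall e, e \notin s -> lpa_ghost K e * u = 0.
  apply/finite_seqP; exists s; apply/seteqP; split=> // e _ /=.
  apply: contraT => /Hs /eqP; apply: contraTT => _; apply: unit_lmul_neq0.
  apply/eqP => e0; have := ghost_edge K e e; rewrite eqxx e0 mul0r => /esym/eqP.
  exact/negP/lpa_vert_neq0.
move: u Cu; apply: lpa_component_ind => [|x y [s Hs] [t Ht]|k x [s Hs]|].
- by exists [::] => e _; rewrite mulr0.
- exists (s ++ t) => e; rewrite mem_cat negb_or => /andP[/Hs es /Ht et].
  by rewrite mulrDr es et addr0.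
- by exists s => e /Hs es; rewrite -lpa_scalerAr es scaler0.
move=> w [|f p] w' q /=; first by lia.
move=> /andP[/eqP<- _] _ _; exists [:: f] => e.
rewrite inE => /negbTE ef.
by rewrite lpa_path_cons -(mulrA (lpa_edge K f)) mulrA ghost_edge ef mul0r.
Qed.

(** A sink annihilates all paths of positive length, hence [u]. *)
Lemma unit_degree1_no_sinks : no_sinks E.
Proof.
move=> v sv; have := unit_lmul_neq0 (lpa_vert_neq0 K v).
move/eqP; apply; move: u Cu.
apply: lpa_component_ind => [|x y vx vy|k x vx|].
- by rewrite mulr0.
- by rewrite mulrDr vx vy addr0.
- by rewrite -lpa_scalerAr vx scaler0.
move=> w [|f p] w' q /=; first by lia.
move=> /andP[/eqP<- _] _ _.
have /negbTE vf : v != src f by rewrite eq_sym; apply/eqP/sv.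
by rewrite lpa_path_cons -(mulrA (lpa_edge K f)) mulrA vert_edge vf mul0r.
Qed.

End UnitOfDegreeOne.

(** * Paths of a given length and end *)

Section PathsTo.
Variables (E : digraph) (s : seq (edge E)).
Implicit Types (v w : vert E) (e : edge E) (x : vert E * seq (edge E)).

(** Paths grow at their end, like the monomials of a Leavitt path algebra when
    they are expanded by the relations at the vertices. *)
Fixpoint paths_to n v : seq (vert E * seq (edge E)) :=
  if n is n'.+1 then
    flatten [seq [seq (x.1, rcons x.2 e) | x <- paths_to n' (src e)]
      | e <- s & rng e == v]
  else [:: (v, [::])].

Lemma size_paths_toS n v :
  size (paths_to n.+1 v) =
  (\sum_(e <- s | rng e == v) size (paths_to n (src e)))%N.
Proof.
rewrite /= size_flatten /shape -map_comp sumnE big_map big_filter.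
by apply: eq_bigr => e _ /=; rewrite size_map.
Qed.

Lemma big_paths_toS (M : nmodType) n v (F : vert E * seq (edge E) -> M) :
  \sum_(x <- paths_to n.+1 v) F x =
  \sum_(e <- s | rng e == v)
    \sum_(x <- paths_to n (src e)) F (x.1, rcons x.2 e).
Proof.
rewrite /= big_flatten big_map big_filter.
by apply: eq_bigr => e _; rewrite big_map.
Qed.

Hypotheses (us : uniq s) (s_all : forall e, e \in s).

Lemma mem_paths_to n v x :
  (x \in paths_to n v) =
  [&& is_path x.1 x.2, path_end x.1 x.2 == v & size x.2 == n].
Proof.
elim: n v x => [|n IH] v [w p] /=.
  rewrite inE xpair_eqE; case: p => [|e p]; rewrite ?andbT ?andbF //=.
apply/flatten_mapP/and3P => /= [[e]|[]].
  rewrite mem_filter => /andP[ev _] /mapP[[w' q]]; rewrite IH /=.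
  move=> /and3P[wq qe /eqP qn] [-> ->].
  by rewrite is_path_rcons wq (eqP qe) eqxx path_end_rcons size_rcons qn.
elim/last_ind: p => [|p e _]; first by rewrite !eqE.
rewrite is_path_rcons path_end_rcons size_rcons => /andP[wp ep] ev pn.
exists e; first by rewrite mem_filter ev s_all.
apply/mapP; exists (w, p) => //; rewrite IH /= wp eq_sym ep.
by rewrite eqSS in pn.
Qed.

Lemma paths_to_uniq n v : uniq (paths_to n v).
Proof.
elim: n v => [|n IH] v //=.
have : uniq [seq e <- s | rng e == v] by rewrite filter_uniq.
elim: [seq _ <- _ | _] => //= e r IHr /andP[er ur].
rewrite cat_uniq IHr // andbT.
rewrite map_inj_uniq ?IH /=; last first.
  by move=> [w p] [w' p'] /= [-> /rcons_inj[->]].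
apply/hasPn => x /flatten_mapP[f fr /mapP[[w p] _ ->]].
apply/mapP => -[[w' p'] _ /= [_]] /rcons_inj[_ fe].
by rewrite -fe fr in er.
Qed.

End PathsTo.

(** * Homogeneous elements as matrices *)

Section Matrices.
Variables (E : digraph) (K : fieldType) (s : seq (edge E)).
Hypotheses (us : uniq s) (s_all : forall e, e \in s) (ns : no_sinks E).
Local Notation L := (lpa E K).
Local Notation C := (@lpa_component E K).
Local Notation paths := (paths_to s).
Local Notation num n v := (size (paths_to s n v)).
Implicit Types (v w : vert E) (e : edge E) (x y : vert E * seq (edge E)).

Definition pel x : L := lpa_path K x.1 x.2.
Definition psel x : L := lpa_path_star K x.1 x.2.

Definition path_nth n v (i : 'I_(num n v)) := nth (v, [::]) (paths n v) i.
Arguments path_nth : clear implicits.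

Lemma path_nth_mem n v i : path_nth n v i \in paths n v.
Proof. exact: mem_nth. Qed.

Lemma pel_vert n v x : x \in paths n v -> pel x * lpa_vert K v = pel x.
Proof.
by rewrite mem_paths_to // => /and3P[? xv _]; rewrite lpa_path_vert // xv.
Qed.

(** Different paths of the same length differ at some edge, and there a ghost
    meets another edge. *)
Lemma psel_pel n v v' x y : x \in paths n v -> y \in paths n v' ->
  psel x * pel y = if x == y then lpa_vert K v else 0.
Proof.
rewrite !mem_paths_to // => /and3P[px /eqP<- /eqP nx] /and3P[py _ /eqP ny].
by rewrite star_path ?nx.
Qed.

Lemma psel_pel_nth n v i v' j :
  psel (path_nth n v i) * pel (path_nth n v' j) =
  if (v == v') && (val i == val j) then lpa_vert K v else 0.
Proof.
rewrite (psel_pel (path_nth_mem i) (path_nth_mem j)).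
have [vv'|vv'] := eqVneq v v'; last first.
  case: eqP => // ij; case/eqP: vv'.
  have := path_nth_mem i; have := path_nth_mem j.
  by rewrite -ij !mem_paths_to // => /and3P[_ /eqP jv _] /and3P[_ /eqP iv _];
     rewrite -iv.
move: j; rewrite -vv' => j.
by rewrite /path_nth nth_uniq // paths_to_uniq.
Qed.

Definition block m n v (X : 'M[K]_(num m v, num n v)) : L :=
  \sum_i \sum_j X i j *: (pel (path_nth m v i) * psel (path_nth n v j)).

(** The matrices attached to the vertices [v] hold the coefficients of the
    [p q^*] with [p] and [q] paths to [v] of length [m] and [n]. *)
Definition Phi m n (X : forall v, 'M[K]_(num m v, num n v)) : L :=
  \sum_v block (X v).

Lemma blockM m n l v (X : 'M_(num m v, num n v)) (Y : 'M_(num n v, num l v)) :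
  block X * block Y = block (X *m Y).
Proof.
rewrite /block mulr_suml; apply: eq_bigr => i _.
under [RHS]eq_bigr => k _ do rewrite mxE scaler_suml.
rewrite [RHS]exchange_big mulr_suml; apply: eq_bigr => j _ /=.
rewrite mulr_sumr (bigD1 j) //= [X in _ + X]big1 => [|j' j'j].
  rewrite addr0 mulr_sumr; apply: eq_bigr => k _.
  rewrite -lpa_scalerAl -lpa_scalerAr scalerA; congr (_ *: _).
  rewrite -mulrA (mulrA (psel _)) psel_pel_nth !eqxx /= mulrA.
  by rewrite (pel_vert (path_nth_mem _)).
rewrite mulr_sumr big1 // => k _.
rewrite -lpa_scalerAl -lpa_scalerAr -mulrA (mulrA (psel _)) psel_pel_nth.
have /negbTE -> : val j != val j' by rewrite eq_sym.
by rewrite andbF mul0r mulr0 !scaler0.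
Qed.

Lemma block_orth m n l v v' (X : 'M_(num m v, num n v))
    (Y : 'M_(num n v', num l v')) :
  v != v' -> block X * block Y = 0.
Proof.
move=> /negbTE vv'; rewrite /block mulr_suml big1 // => i _.
rewrite mulr_suml big1 // => j _; rewrite mulr_sumr big1 // => j' _.
rewrite mulr_sumr big1 // => k _.
rewrite -lpa_scalerAl -lpa_scalerAr -mulrA (mulrA (psel _)) psel_pel_nth vv'.
by rewrite mul0r mulr0 !scaler0.
Qed.

Lemma PhiM m n l (X : forall v, 'M_(num m v, num n v))
    (Y : forall v, 'M_(num n v, num l v)) :
  Phi X * Phi Y = Phi (fun v => X v *m Y v).
Proof.
rewrite /Phi mulr_suml; apply: eq_bigr => v _.
rewrite mulr_sumr (bigD1 v) //= blockM big1 ?addr0 // => v' v'v.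
by rewrite block_orth // eq_sym.
Qed.

Lemma vert_sum v :
  lpa_vert K v = \sum_(e <- s | src e == v) lpa_edge K e * lpa_ghost K e.
Proof.
rewrite -big_filter; apply: vert_regular.
- have [e ev] : exists e, src e = v.
    by apply: contrapT => nv; apply: (ns (v := v)) => e ev; apply: nv; exists e.
  move=> s0; have : e \in [seq e <- s | src e == v].
    by rewrite mem_filter s_all ev eqxx.
  by rewrite s0.
- exact: filter_uniq.
- by move=> e; rewrite mem_filter s_all andbT.
Qed.

Lemma pel_psel_expand n v x y : x \in paths n v ->
  pel x * psel y = \sum_(e <- s | src e == v)
    pel (x.1, rcons x.2 e) * psel (y.1, rcons y.2 e).
Proof.
move=> xv; rewrite -(pel_vert xv) vert_sum mulr_sumr mulr_suml.
apply: eq_bigr => e _.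
by rewrite /pel /psel /= lpa_path_rcons lpa_path_star_rcons !mulrA.
Qed.

(** The partition of unity into the [p p^*] with [p] of length [n]: it is the sum
    of the vertices for [n = 0], and expanding each term at the end of [p] leads
    from [n] to [n + 1]. *)
Lemma sum_paths n : \sum_v \sum_(x <- paths n v) pel x * psel x = 1.
Proof.
elim: n => [|n IH].
  rewrite lpa_oneE; apply: eq_bigr => v _.
  by rewrite big_seq1 /pel /psel lpa_path_nil lpa_path_star_nil vertM eqxx.
rewrite -IH.
under [RHS]eq_bigr => v _.
  rewrite big_seq; under eq_bigr => x xv do rewrite (pel_psel_expand x xv).
  rewrite -big_seq exchange_big /=; over.
pose F e := \sum_(x <- paths n (src e))
  pel (x.1, rcons x.2 e) * psel (x.1, rcons x.2 e).
transitivity (\sum_v \sum_(e <- s | rng e == v) F e).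
  by apply: eq_bigr => v _; rewrite big_paths_toS.
transitivity (\sum_(e <- s) F e).
  rewrite (exchange_big_dep predT) //=; apply: eq_bigr => e _.
  by rewrite (big_pred1 (rng e)) // => v /=; rewrite eq_sym.
transitivity (\sum_v \sum_(e <- s | src e == v) F e).
  rewrite (exchange_big_dep predT) //=; apply: eq_bigr => e _.
  by rewrite (big_pred1 (src e)) // => v /=; rewrite eq_sym.
by apply: eq_bigr => v _; apply: eq_bigr => e /eqP <-.
Qed.

Lemma Phi1 n : Phi (m := n) (n := n) (fun v => 1%:M) = 1.
Proof.
rewrite -(sum_paths n) /Phi; apply: eq_bigr => v _.
rewrite (big_nth (v, [::])) big_mkord /block; apply: eq_bigr => i _.
rewrite (bigD1 i) //= big1 => [|j ji].
  by rewrite addr0 mxE eqxx scale1r.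
by rewrite mxE eq_sym (negbTE ji) scale0r.
Qed.

(** Multiplying by [p^*] and [q] isolates the coefficient of [p q^*]. *)
Lemma Phi_coef m n (X : forall v, 'M_(num m v, num n v)) v i j :
  psel (path_nth m v i) * Phi X * pel (path_nth n v j) =
  X v i j *: lpa_vert K v.
Proof.
rewrite /Phi mulr_sumr mulr_suml (bigD1 v) //= [X in _ + X]big1 => [|v' v'v].
  rewrite addr0 /block mulr_sumr mulr_suml (bigD1 i) //= [X in _ + X]big1.
    rewrite addr0 mulr_sumr mulr_suml (bigD1 j) //= [X in _ + X]big1.
      rewrite addr0 -lpa_scalerAr -lpa_scalerAl; congr (_ *: _).
      rewrite mulrA psel_pel_nth !eqxx /= -mulrA psel_pel_nth !eqxx /=.
      by rewrite vertM eqxx.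
    move=> j' /negbTE j'j; rewrite -lpa_scalerAr -lpa_scalerAl.
    rewrite mulrA -[_ * _ * psel _ * _]mulrA.
    rewrite [psel _ * _ in X in _ * X]psel_pel_nth.
    by rewrite eqxx [val _ == val _]j'j mulr0 scaler0.
  move=> i' /negbTE i'i; rewrite mulr_sumr mulr_suml big1 // => j' _.
  rewrite -lpa_scalerAr -lpa_scalerAl mulrA psel_pel_nth eqxx.
  by rewrite eq_sym [val _ == val _]i'i /= !mul0r scaler0.
rewrite /block mulr_sumr mulr_suml big1 // => i' _.
rewrite mulr_sumr mulr_suml big1 // => j' _.
rewrite -lpa_scalerAr -lpa_scalerAl mulrA psel_pel_nth eq_sym (negbTE v'v).
by rewrite !mul0r scaler0.
Qed.

Lemma Phi_inj m n (X Y : forall v, 'M_(num m v, num n v)) :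
  Phi X = Phi Y -> forall v, X v = Y v.
Proof.
move=> XY v; apply/matrixP => i j; have := Phi_coef X i j.
rewrite XY Phi_coef => /eqP; rewrite -subr_eq0 -scalerBl.
apply: contraTeq => XYij.
apply: contra (lpa_vert_neq0 K v) => /eqP h.
rewrite -[lpa_vert K v]scale1r -(@mulVf _ (Y v i j - X v i j)).
  by rewrite -scalerA h scaler0.
by rewrite subr_eq0 eq_sym.
Qed.

Lemma Phi_component m n (X : forall v, 'M_(num m v, num n v)) :
  C (m%:Z - n%:Z) (Phi X).
Proof.
apply: component_sum => v; apply: component_sum => i.
apply: component_sum => j; apply: spanZ.
have := path_nth_mem i; have := path_nth_mem j.
rewrite !mem_paths_to // => /and3P[pj _ /eqP sj] /and3P[pi _ /eqP si].
by apply: component_monomial; rewrite ?si ?sj.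
Qed.

Definition Phi_image m n (a : L) :=
  exists X : forall v, 'M_(num m v, num n v), a = Phi X.

Lemma Phi_image0 m n : Phi_image m n 0.
Proof.
exists (fun=> 0); rewrite /Phi big1 // => v _; rewrite /block big1 // => i _.
by rewrite big1 // => j _; rewrite mxE scale0r.
Qed.

Lemma Phi_imageD m n a b :
  Phi_image m n a -> Phi_image m n b -> Phi_image m n (a + b).
Proof.
move=> [X ->] [Y ->]; exists (fun v => X v + Y v).
rewrite /Phi -big_split; apply: eq_bigr => v _.
rewrite /block -big_split; apply: eq_bigr => i _ /=.
by rewrite -big_split; apply: eq_bigr => j _; rewrite mxE scalerDl.
Qed.

Lemma Phi_imageZ m n k a : Phi_image m n a -> Phi_image m n (k *: a).
Proof.
move=> [X ->]; exists (fun v => k *: X v).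
rewrite /Phi scaler_sumr; apply: eq_bigr => v _.
rewrite /block scaler_sumr; apply: eq_bigr => i _ /=.
by rewrite scaler_sumr; apply: eq_bigr => j _; rewrite mxE scalerA.
Qed.

Lemma Phi_image_sum (I : eqType) (r : seq I) (Q : pred I) (F : I -> L) m n :
  (forall i, Q i -> Phi_image m n (F i)) ->
  Phi_image m n (\sum_(i <- r | Q i) F i).
Proof.
move=> QF; apply: big_ind => //; first exact: Phi_image0.
exact: Phi_imageD.
Qed.

Lemma Phi_image_monomial m n v x y : x \in paths m v -> y \in paths n v ->
  Phi_image m n (pel x * psel y).
Proof.
move=> xv yv; exists (fun v' => \matrix_(i, j)
  ((path_nth m v' i == x) && (path_nth n v' j == y))%:R).
rewrite /Phi (bigD1 v) //= [X in _ + X]big1 => [|v' /eqP v'v]; last first.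
  rewrite /block big1 // => i _; rewrite big1 // => j _; rewrite mxE.
  case: eqP => [ix|_]; last by rewrite scale0r.
  case: v'v; have := path_nth_mem i; move: xv; rewrite ix !mem_paths_to //.
  by move=> /and3P[_ /eqP<- _] /and3P[_ /eqP<- _].
have xi : (index x (paths m v) < num m v)%N by rewrite index_mem.
have yj : (index y (paths n v) < num n v)%N by rewrite index_mem.
have ix (i : 'I_(num m v)) : path_nth m v i = x -> i = Ordinal xi.
  move=> xE; apply: val_inj; rewrite /= -xE /path_nth index_uniq //.
  exact: paths_to_uniq.
have jy (j : 'I_(num n v)) : path_nth n v j = y -> j = Ordinal yj.
  move=> yE; apply: val_inj; rewrite /= -yE /path_nth index_uniq //.
  exact: paths_to_uniq.
have xE : path_nth m v (Ordinal xi) = x by rewrite /path_nth /= nth_index.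
have yE : path_nth n v (Ordinal yj) = y by rewrite /path_nth /= nth_index.
rewrite addr0 /block (bigD1 (Ordinal xi)) //= [X in _ + X]big1 => [|i /eqP ii].
  rewrite addr0 (bigD1 (Ordinal yj)) //= [X in _ + X]big1 => [|j /eqP jj].
    by rewrite addr0 mxE xE yE !eqxx scale1r.
  by rewrite mxE [_ == y]negbTE ?andbF ?scale0r //; apply/eqP => /jy.
rewrite big1 // => j _.
by rewrite mxE [_ == x]negbTE ?scale0r //; apply/eqP => /ix.
Qed.

Lemma Phi_imageS m n a : Phi_image m n a -> Phi_image m.+1 n.+1 a.
Proof.
move=> [X ->]; rewrite /Phi; apply: Phi_image_sum => v _.
rewrite /block; apply: Phi_image_sum => i _.
apply: Phi_image_sum => j _; apply: Phi_imageZ.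
rewrite (pel_psel_expand _ (path_nth_mem i)); apply: Phi_image_sum => e ev.
have := path_nth_mem i; have := path_nth_mem j.
rewrite !mem_paths_to // => /and3P[pj jv sj] /and3P[pi iv si].
apply: (@Phi_image_monomial _ _ (rng e)); rewrite mem_paths_to //=;
  rewrite is_path_rcons path_end_rcons size_rcons eqxx eqSS.
- by rewrite pi si (eqP iv) ev.
- by rewrite pj sj (eqP jv) ev.
Qed.

(** An element of degree [d] involves finitely many [p q^*]; the relations at
    the vertices rewrite each of them in terms of longer ones. *)
Lemma component_Phi d a : C d a -> exists N : nat, forall m n : nat,
  (N <= m)%N -> (N <= n)%N -> m%:Z - n%:Z = d -> Phi_image m n a.
Proof.
move: a; apply: lpa_component_ind.
- by exists 0 => m n _ _ _; exact: Phi_image0.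
- move=> x y [N1 H1] [N2 H2]; exists (maxn N1 N2) => m n.
  rewrite !geq_max => /andP[m1 m2] /andP[n1 n2] mn.
  by apply: Phi_imageD; [exact: H1 | exact: H2].
- move=> k x [N H]; exists N => m n Nm Nn mn.
  by apply: Phi_imageZ; exact: H.
move=> w p w' q wp wq pq.
have [pqe|pqe] := eqVneq (path_end w p) (path_end w' q).
  exists (size p + size q)%N => m n Nm Nn mn.
  have [t -> ->] : exists2 t, m = (t + size p)%N & n = (t + size q)%N.
    by exists (m - size p)%N; lia.
  elim: t => [|t IH]; last by rewrite !addSn; exact: Phi_imageS.
  apply: (@Phi_image_monomial _ _ (path_end w p) (w, p) (w', q));
    rewrite mem_paths_to //=.
    by rewrite wp !eqxx.
  by rewrite wq -pqe !eqxx.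
(* Without a common end, the product of the path and the star vanishes. *)
exists 0 => m n _ _ _; suff -> : lpa_path K w p * lpa_path_star K w' q = 0.
  exact: Phi_image0.
have <- : lpa_path K w p * lpa_vert K (path_end w p) = lpa_path K w p.
  by rewrite lpa_path_vert // eqxx.
rewrite -mulrA vert_lpa_path_star // eq_sym (negbTE pqe).
by rewrite mulr0.
Qed.

End Matrices.

(** * Units and the growth of the number of paths *)

(** If [A = L D U] with [L], [U] invertible and [D] idempotent, take
    [B = U^-1 L^-1]. *)
Lemma unit_regular_mx (K : fieldType) m n (A : 'M[K]_(m, n)) : m = n ->
  exists B : 'M_(n, m), exists B' : 'M_(m, n),
    [/\ B *m B' = 1%:M, B' *m B = 1%:M & A *m B *m A = A].
Proof.
move=> mn; subst n.
have [L [U [Lu Uu AE]]] : exists L U, [/\ L \in unitmx, U \in unitmx &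
    A = L *m pid_mx (\rank A) *m U].
  exists (col_ebase A), (row_ebase A).
  by rewrite mulmx_ebase col_ebase_unit row_ebase_unit.
exists (invmx U *m invmx L), (L *m U); split.
- by rewrite mulmxA mulmxKV // mulVmx.
- by rewrite mulmxA mulmxK // mulmxV.
- have rA := rank_leq_row A; move: (\rank A) rA AE => r rA ->.
  rewrite !mulmxA mulmxK // mulmxKV //. 
  by rewrite -[L *m _ *m pid_mx r]mulmxA pid_mx_id.
Qed.

Section Stability.
Variables (E : digraph) (K : fieldType) (s : seq (edge E)).
Hypotheses (us : uniq s) (s_all : forall e, e \in s) (ns : no_sinks E).
Local Notation L := (lpa E K).
Local Notation C := (@lpa_component E K).
Local Notation num n v := (size (paths_to s n v)).

(** Equivalently, the matrices of [Phi m n] are square for all large [m] and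
    [n]. *)
Definition stable_from N := forall n v, (N <= n)%N -> num n.+1 v = num n v.

Lemma stable_fromE N m n v : stable_from N -> (N <= m)%N -> (N <= n)%N ->
  num m v = num n v.
Proof.
move=> st; have numN t : num (N + t) v = num N v.
  elim: t => [|t IH]; first by rewrite addn0.
  by rewrite addnS st ?leq_addr.
by move=> /subnKC<- /subnKC<-; rewrite !numN.
Qed.

(** At level [(n + 1, n)] a unit of degree 1 becomes a family of invertible
    matrices, which are square. *)
Lemma unit_degree1_stable u u' :
  C 1 u -> u * u' = 1 -> u' * u = 1 -> exists N, stable_from N.
Proof.
move=> Cu uu' u'u; have Cu' := homogeneous_inverse Cu uu' u'u.
have [N1 H1] := component_Phi us s_all ns Cu.
have [N2 H2] := component_Phi us s_all ns Cu'.
exists (maxn N1 N2) => n v; rewrite geq_max => /andP[n1 n2].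
have [|||X uX] := H1 n.+1 n; [lia..|].
have [|||Y uY] := H2 n n.+1; [lia..|].
move: uu' u'u; rewrite uX uY !PhiM // => XY YX.
have := etrans XY (esym (Phi1 K us s_all ns n.+1)).
move=> /(Phi_inj us s_all)/(_ v)/mulmx1_min le1.
have := etrans YX (esym (Phi1 K us s_all ns n)).
move=> /(Phi_inj us s_all)/(_ v)/mulmx1_min le2.
by apply/eqP; rewrite eqn_leq le1 le2.
Qed.

Variable N : nat.
Hypothesis st : stable_from N.

Lemma large_difference (d : int) :
  exists m n : nat, [/\ (N <= m)%N, (N <= n)%N & m%:Z - n%:Z = d].
Proof.
case: d => d; first by exists (N + d)%N, N; split; lia.
by exists N, (N + d.+1)%N; split; lia.
Qed.

(** A bijection between the paths of length [m] and [n], for each end, makes a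
    unit of degree [m - n]. *)
Lemma stable_homogeneous_unit d :
  exists u w, [/\ C d u, C (- d) w, u * w = 1 & w * u = 1].
Proof.
have [m [n [Nm Nn <-]]] := large_difference d.
have num_mn v : num m v = num n v by exact: (stable_fromE v st).
exists (Phi (fun v => pid_mx (num n v) : 'M[K]_(num m v, num n v))).
exists (Phi (fun v => pid_mx (num n v) : 'M[K]_(num n v, num m v))).
split; first exact: Phi_component.
- by rewrite opprB; exact: Phi_component.
- rewrite PhiM // -(Phi1 K us s_all ns m).
  congr Phi; apply: functional_extensionality_dep => v.
  by rewrite pid_mx_id // -num_mn pid_mx_1.
- rewrite PhiM // -(Phi1 K us s_all ns n).
  congr Phi; apply: functional_extensionality_dep => v.
  by rewrite pid_mx_id ?num_mn // pid_mx_1.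
Qed.

Lemma stable_strongly_graded : strongly_graded C.
Proof.
move=> g d; apply/seteqP; split=> a.
  move=> [r rC ->]; rewrite big_seq.
  apply: (big_ind (C (g + d))); [exact: span0 | exact: spanD |].
  by move=> y /rC[]; exact: componentM.
move=> Ca; have [u [w [Cu Cw uw _]]] := stable_homogeneous_unit g.
exists [:: (u, w * a)]; last by rewrite big_seq1 mulrA uw mul1r.
move=> y; rewrite inE => /eqP -> /=; split=> //.
by rewrite -[d](addKr g); exact: componentM.
Qed.

(** The unit-regularity of matrices, applied to the matrix at each vertex. *)
Lemma stable_graded_unit_regular : graded_unit_regular C.
Proof.
move=> d a Ca _; have [N1 H1] := component_Phi us s_all ns Ca.
have [m [n [Nm Nn mn]]] := large_difference d.
have [|||X aX] := H1 (N1 + m)%N (N1 + n)%N; [lia..|].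
have num_mn v : num (N1 + m) v = num (N1 + n) v.
  by apply: (stable_fromE v st); lia.
(* [Y v] is the invertible matrix that regularity gives at [v], [Y' v] its
   inverse. *)
have Y v := cid (unit_regular_mx (X v) (num_mn v)).
have Y' v := cid (projT2 (Y v)).
exists (Phi (fun v => projT1 (Y v))).
  split.
    have -> : - d = (N1 + n)%N%:Z - (N1 + m)%N%:Z by lia.
    exact: Phi_component.
  exists (Phi (fun v => projT1 (Y' v))); rewrite !PhiM //; split.
  - rewrite -(Phi1 K us s_all ns (N1 + n)).
    congr Phi; apply: functional_extensionality_dep => v.
    by have [] := projT2 (Y' v).
  - rewrite -(Phi1 K us s_all ns (N1 + m)).
    congr Phi; apply: functional_extensionality_dep => v.
    by have [] := projT2 (Y' v).
rewrite aX !PhiM //; congr Phi; apply: functional_extensionality_dep => v.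
by have [] := projT2 (Y' v).
Qed.

End Stability.

(** * Cycles without exits *)

Section Cycles.
Variable E : digraph.
Implicit Types (v w : vert E) (e f : edge E) (c p q : seq (edge E)).
Local Notation srcs p := [seq src e | e <- p].

Lemma srcs_inj c : uniq (srcs c) -> {in c &, injective (@src E)}.
Proof.
elim: c => //= g c IH /andP[gc uc] e f; rewrite !inE.
case/predU1P => [->|ec]; case/predU1P => [->|fc] // ef.
- by rewrite ef map_f in gc.
- by rewrite -ef map_f in gc.
- exact: IH.
Qed.

Lemma on_cycleP c v : on_cycle c v -> exists2 e, e \in c & src e = v.
Proof. by move=> /mapP[e ec ->]; exists e. Qed.

Lemma on_cycle_rng c e : is_cycle c -> e \in c -> on_cycle c (rng e).
Proof.
move=> /and3P[_ cc _] ec; have /eqP -> := next_cycle cc ec.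
by apply: map_f; rewrite mem_next.
Qed.

Lemma on_cycle_pred c v : is_cycle c -> on_cycle c v ->
  exists2 e, rng e = v & on_cycle c (src e).
Proof.
move=> /and3P[_ cc _] /on_cycleP[f fc <-]; exists (prev c f).
  exact/eqP/(prev_cycle cc).
by apply: map_f; rewrite mem_prev.
Qed.

Lemma path_cycleE e p : path (fun f g => rng f == src g) e p = is_path (rng e) p.
Proof. by elim: p e => //= f p IH e; rewrite eq_sym IH. Qed.

Lemma cycle_at c v : is_cycle c -> on_cycle c v ->
  exists i, [/\ is_path v (rot i c), path_end v (rot i c) = v &
    exists e p, rot i c = e :: p /\ src e = v].
Proof.
move=> /and3P[_ cc _] /on_cycleP[e ec <-]; exists (index e c).
move: cc; rewrite -(rot_cycle (index e c)) (rot_index ec) /=.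
rewrite path_cycleE is_path_rcons => /andP[-> /eqP pe]; rewrite eqxx; split=> //.
by exists e; eexists.
Qed.

(** The last vertex [src e] that is left again later, up to its next occurrence,
    bounds a closed path with distinct sources. *)
Lemma nonuniq_cycle w p : is_path w p -> ~~ uniq (srcs p) ->
  exists p1 c p2, p = p1 ++ c ++ p2 /\ is_cycle c.
Proof.
elim: p w => //= e p IH w /andP[_ ep]; rewrite negb_and negbK.
have [up|nup] := boolP (uniq (srcs p)); last first.
  by have [p1 [c [p2 [-> cc]]]] := IH _ ep nup; exists (e :: p1), c, p2.
rewrite orbF => sp; set j := index (src e) (srcs p).
exists [::], (e :: take j p), (drop j p); rewrite /= cat_take_drop; split=> //.
have jp : (j < size p)%N by rewrite -(size_map (@src E)) index_mem.
move: ep; rewrite -{1}(cat_take_drop j p) is_path_cat => /andP[ep].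
rewrite (drop_nth e jp) /= => /andP[/eqP pe _].
rewrite /is_cycle /= path_cycleE is_path_rcons ep /= -pe.
rewrite -(nth_map _ (src e)) // nth_index // eqxx /= map_take take_uniq // andbT.
by rewrite in_take // ltnn.
Qed.

Hypothesis ne : no_exit E.

Lemma cycle_edge c e : is_cycle c -> on_cycle c (src e) -> e \in c.
Proof.
move=> cc ce; apply: contrapT => /negP ec; apply: (ne cc).
by exists e.
Qed.

Lemma path_on_cycle c v p : is_cycle c -> on_cycle c v -> is_path v p ->
  on_cycle c (path_end v p).
Proof.
move=> cc; elim: p v => //= e p IH v cv /andP[/eqP ev ep].
apply: (IH (rng e)) => //; apply: on_cycle_rng => //.
by apply: cycle_edge => //; rewrite ev.
Qed.

(** Without exits, a vertex on a cycle emits exactly one edge. *)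
Lemma path_cycle_uniq c v p q : is_cycle c -> on_cycle c v ->
  is_path v p -> is_path v q -> size p = size q -> p = q.
Proof.
move=> cc; elim: p v q => [|e p IH] v [|f q] //= cv /andP[/eqP ev ep].
move=> /andP[/eqP fv fq] [pq].
have ec : e \in c by apply: cycle_edge => //; rewrite ev.
have fc : f \in c by apply: cycle_edge => //; rewrite fv.
have /and3P[_ _ uc] := cc.
have ef : e = f by apply: (srcs_inj uc) => //; rewrite ev.
by rewrite -ef in fq *; rewrite (IH (rng e) q) //; exact: on_cycle_rng.
Qed.

(** By uniqueness the path starts with laps of [c]; what remains is a proper
    initial segment of a lap, and it cannot be closed unless it is empty, since
    the sources of a cycle are distinct. *)
Lemma closed_path_dvd c v q : is_cycle c -> on_cycle c v ->
  is_path v q -> path_end v q = v -> (size c %| size q)%N.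
Proof.
move=> cc cv; have [i [pd de [e [d' [dE ev]]]]] := cycle_at cc cv.
have /and3P[_ _ uc] := cc.
have ud : uniq (srcs (rot i c)) by rewrite map_rot rot_uniq.
have [n] := ubnP (size q); elim: n q => // n IH q.
rewrite ltnS => qn pq qe; have [cq|qc] := leqP (size c) (size q).
  have tq : take (size c) q = rot i c.
    apply: (path_cycle_uniq cc cv) => //; last by rewrite size_rot size_takel.
    by move: pq; rewrite -{1}(cat_take_drop (size c) q) is_path_cat => /andP[].
  move: pq qe; rewrite -(cat_take_drop (size c) q) tq is_path_cat path_end_cat.
  rewrite de pd size_cat size_rot /= => pq qe; rewrite dvdn_addr //.
  apply: IH => //; rewrite size_drop.
  have : (0 < size c)%N by rewrite -(size_rot i) dE.
  lia.
have qE : take (size q) (rot i c) = q.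
  apply: (path_cycle_uniq cc cv) => //; last by rewrite size_takel // size_rot ltnW.
  by move: pd; rewrite -{1}(cat_take_drop (size q) (rot i c)) is_path_cat => /andP[].
case: (posnP (size q)) => [->//|q0]; exfalso.
have qc' : (size q < size (rot i c))%N by rewrite size_rot.
move: pd; rewrite -(cat_take_drop (size q) (rot i c)) qE is_path_cat qe.
rewrite (drop_nth e qc') /= => /and3P[_ /eqP].
rewrite dE in ud qc' *; case: (size q) q0 qc' => // n' _ /=; rewrite ltnS => nd.
move: ud => /= /andP[/negP + _]; rewrite ev => h fv _; apply: h.
by rewrite -fv; apply/map_f/mem_nth.
Qed.

Lemma laps c v t : is_cycle c -> on_cycle c v ->
  exists q, [/\ is_path v q, path_end v q = v & size q = (t * size c)%N].
Proof.
move=> cc cv; have [i [pd de _]] := cycle_at cc cv.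
elim: t => [|t [q [pq qe qs]]]; first by exists [::].
exists (rot i c ++ q).
by rewrite is_path_cat path_end_cat pd de pq qe size_cat size_rot qs mulSn.
Qed.

(** A path that ends in [v] and has left [v] before cannot but go around the
    cycle. *)
Lemma contains_cycleE c v w p : is_cycle c -> on_cycle c v ->
  is_path w p -> path_end w p = v -> contains_cycle c p <-> v \in srcs p.
Proof.
move=> cc cv wp pv; split=> [[i ip]|].
  have : v \in srcs (rot i c) by rewrite map_rot mem_rot.
  by move=> /mapP[e ec ->]; apply/map_f/(mem_infix ip).
move=> /mapP[e ep ev]; case/splitPr: ep wp pv => p1 p2.
rewrite is_path_cat path_end_cat /= -ev => /and3P[_ /eqP vE e2] pv.
have pq : is_path v (e :: p2) by rewrite /= -ev eqxx.
have qe : path_end v (e :: p2) = v by rewrite -pv -vE ev.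
have /dvdn_leq -/(_ isT) cq := closed_path_dvd cc cv pq qe.
have [i [pd de _]] := cycle_at cc cv; exists i; apply/infixP.
exists p1, (drop (size c) (e :: p2)); congr (_ ++ _).
rewrite -{1}(cat_take_drop (size c) (e :: p2)); congr (_ ++ _).
apply: (path_cycle_uniq cc cv) => //; last by rewrite size_rot size_takel.
by move: pq; rewrite -{1}(cat_take_drop (size c) (e :: p2)) is_path_cat => /andP[].
Qed.

End Cycles.

(** * Counting the paths that end on a cycle *)

Section Counting.
Local Open Scope nat_scope.
Variables (E : digraph) (s : seq (edge E)).
Hypotheses (us : uniq s) (s_all : forall e, e \in s) (ns : no_sinks E).
Implicit Types (v w : vert E) (e f : edge E) (c p q : seq (edge E)).
Implicit Types (x y : vert E * seq (edge E)).
Local Notation srcs p := [seq src e | e <- p].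
Local Notation paths := (paths_to s).
Local Notation num n v := (size (paths_to s n v)).

Lemma num_gt0 c v n : is_cycle c -> on_cycle c v -> 0 < num n v.
Proof.
move=> cc; elim: n v => [|n IH] v cv //.
have [e ev ce] := on_cycle_pred cc cv.
by rewrite size_paths_toS (big_rem e) //= ev eqxx addn_gt0 IH.
Qed.

Lemma out_edge v : exists e, src e = v.
Proof.
by apply: contrapT => nv; apply: (ns (v := v)) => e ev; apply: nv; exists e.
Qed.

(** Counted by their last edges, the paths of length [n + 1] are as many as the
    sum over [v] of [num n v] times the number of edges that [v] emits.  As each
    [v] emits an edge, it emits only one if [num n v] is positive and the numbers
    are the same for [n + 1]. *)
Lemma stable_no_exit N : stable_from s N -> no_exit E.
Proof.
move=> st c cc [f [cf fc]].
have [g gc gf] := on_cycleP cf.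
have fg : f != g by apply: contraNneq fc => ->.
have sumE : \sum_v num N v = \sum_v \sum_(e <- s | src e == v) num N v.
  transitivity (\sum_v num N.+1 v); first by apply: eq_bigr => v _; rewrite st.
  under eq_bigr => v _ do rewrite size_paths_toS.
  rewrite (exchange_big_dep predT) //= [RHS](exchange_big_dep predT) //=.
  apply: eq_bigr => e _.
  rewrite (big_pred1 (rng e)); last by move=> v /=; rewrite eq_sym.
  by rewrite (big_pred1 (src e)) // => v /=; rewrite eq_sym.
have out v : num N v <= \sum_(e <- s | src e == v) num N v.
  have [e ev] := out_edge v.
  by rewrite (big_rem e) //= ev eqxx leq_addr.
have out2 : num N (src f) < \sum_(e <- s | src e == src f) num N (src f).
  have gs : g \in rem f s by rewrite mem_rem_uniq // inE eq_sym fg s_all.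
  rewrite (big_rem f) //= eqxx (big_rem g) //= gf eqxx.
  by rewrite addnA ltn_addr // -addn1 leq_add2l (num_gt0 N cc cf).
have := sumE; rewrite (bigD1 (src f)) //= [RHS](bigD1 (src f)) //= => /eqP.
by rewrite ltn_eqF // -addSn leq_add // leq_sum.
Qed.

(** The sets whose cardinality Condition (EDL) prescribes. *)
Definition arrivals c v i : set (vert E * seq (edge E)) :=
  [set x | [/\ is_path x.1 x.2, path_end x.1 x.2 = v,
    ~ contains_cycle c x.2 & size x.2 %% size c = i]]%classic.

Definition first_arrival v x := (x.1, take (index v (srcs x.2)) x.2).

Lemma first_arrivalP v x : is_path x.1 x.2 -> path_end x.1 x.2 = v ->
  exists p q, [/\ x.2 = p ++ q, first_arrival v x = (x.1, p),
    path_end x.1 p = v, v \notin srcs p & is_path v q].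
Proof.
case: x => w r /= wr rv; set j := index v (srcs r).
exists (take j r), (drop j r); rewrite cat_take_drop.
have vj : v \notin srcs (take j r).
  by rewrite map_take in_take_leq ?index_size // ltnn.
have [jr|] := boolP (v \in srcs r); last first.
  move=> vr; have jE : j = size r by rewrite /j memNindex // size_map.
  by rewrite /first_arrival /= -/j jE take_size drop_size.
have j_lt : j < size r by rewrite -(size_map (@src E)) index_mem.
have [e _ _] := mapP jr; move: wr; rewrite -{1}(cat_take_drop j r) is_path_cat.
rewrite (drop_nth e j_lt) /= => /and3P[_ /eqP pe qe].
have vE : src (nth e r j) = v by rewrite -(nth_map _ v) // nth_index.
by rewrite -pe vE eqxx.
Qed.

Hypothesis ne : no_exit E.
Variables (c : seq (edge E)) (v : vert E).
Hypotheses (cc : is_cycle c) (cv : on_cycle c v).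

Lemma size_cycle_gt0 : 0 < size c.
Proof. by have /and3P[] := cc; rewrite -size_eq0 -lt0n. Qed.

Lemma arrivalsE i x : arrivals c v i x <->
  [/\ is_path x.1 x.2, path_end x.1 x.2 = v, v \notin srcs x.2 &
    size x.2 %% size c = i].
Proof.
split=> -[px xv nx xi]; split=> //.
  by apply/negP => /(contains_cycleE ne cc cv px xv).
by move=> /(contains_cycleE ne cc cv px xv); exact/negP.
Qed.

(** Without exits, a path to [v] is determined by its length and its part up to
    the first visit of [v], and after this visit it goes around the cycle a whole
    number of times. *)
Lemma arrivals_count n :
    (forall x, arrivals c v (n %% size c) x -> size x.2 <= n) ->
  (arrivals c v (n %% size c) #= `I_(num n v))%card.
Proof.
move=> bound; set l := [seq first_arrival v x | x <- paths n v].
have lE : arrivals c v (n %% size c) = [set` l]%classic.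
  apply/seteqP; split=> x /=.
    move=> ax; have xn := bound x ax; move: ax => /arrivalsE[px xv nx xi].
    have [t nE] : exists t, n = size x.2 + t * size c.
      exists ((n - size x.2) %/ size c); rewrite divnK ?subnKC //.
      by rewrite -eqn_mod_dvd // xi.
    have [q [pq qe qs]] := laps t cc cv.
    apply/mapP; exists (x.1, x.2 ++ q).
      by rewrite mem_paths_to //= is_path_cat path_end_cat px xv pq qe size_cat
        qs nE !eqxx.
    rewrite /first_arrival /= map_cat index_cat (negbTE nx) size_map.
    have -> : index v (srcs q) = 0.
      by case: (q) pq => //= e r /andP[->].
    by rewrite addn0 take_size_cat //; case: (x).
  move=> /mapP[y]; rewrite mem_paths_to // => /and3P[py /eqP yv /eqP yn] ->.
  apply/arrivalsE; have [p [q [yE -> pv np vq]]] := first_arrivalP py yv.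
  move: py yv yn; rewrite yE is_path_cat path_end_cat pv size_cat /=.
  move=> /andP[yp _] qv <-; split=> //.
  have /dvdnP[t ->] := closed_path_dvd ne cc cv vq qv.
  by rewrite addnC modnMDl.
have ul : uniq l.
  rewrite map_inj_in_uniq ?paths_to_uniq // => x y.
  rewrite !mem_paths_to //.
  move=> /and3P[px /eqP xv /eqP xn] /and3P[py /eqP yv /eqP yn].
  have [p [q [xE -> _ _ vq]]] := first_arrivalP px xv.
  have [p' [q' [yE -> _ _ vq']]] := first_arrivalP py yv.
  move: xE yE xn yn; case: (x) => x1 x2; case: (y) => y1 y2 /= -> -> xn yn.
  move=> [-> pp]; rewrite -pp in yn *; congr (_, _ ++ _).
  apply: (path_cycle_uniq ne cc cv) => //.
  by move: xn yn; rewrite !size_cat => <- /addnI.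
rewrite lE -(size_map (first_arrival v)) -/l card_eq_sym.
have -> : ([set` l] = (fun i => nth (v, [::]) l i) @` `I_(size l))%classic.
  apply/seteqP; split=> x /=.
    by move=> xl; exists (index x l); rewrite ?nth_index // /mkset index_mem.
  by move=> [i il <-]; exact: mem_nth.
rewrite card_eq_sym; apply: inj_card_eq => i j.
rewrite !inE => il jl /eqP; rewrite nth_uniq //; exact/eqP.
Qed.

(** A long path that reaches [v] for the first time differs from all paths to [v]
    that end with a lap, so that it would make the number of paths grow. *)
Lemma stable_arrivals_bounded N i x : stable_from s N ->
  arrivals c v i x -> size x.2 < N + size c.
Proof.
move=> st /arrivalsE[px xv nx _]; rewrite ltnNge; apply/negP => xN.
have [j [pd de [e [d' [dE ev]]]]] := cycle_at cc cv.
set d := rot j c in pd de dE.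
set n := size x.2 in xN; have c0 := size_cycle_gt0.
pose l := x :: [seq (y.1, y.2 ++ d) | y <- paths (n - size c) v].
have ul : uniq l.
  rewrite /= map_inj_uniq ?paths_to_uniq // ?andbT.
    apply: contra nx => /mapP[y _ ->] /=.
    by rewrite map_cat mem_cat dE /= ev in_cons eqxx orbT.
  move=> [a a'] [b b'] /= [-> /(congr1 rev)/eqP].
  by rewrite !rev_cat eqseq_cat // => /andP[_ /eqP/(can_inj revK) ->].
have sl : {subset l <= paths n v}.
  move=> y; rewrite inE => /predU1P[->|].
    by rewrite mem_paths_to // px xv !eqxx.
  move=> /mapP[z]; rewrite !mem_paths_to // => /and3P[pz /eqP zv /eqP zn] -> /=.
  rewrite is_path_cat path_end_cat pz zv pd de size_cat zn size_rot eqxx.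
  by rewrite subnK ?eqxx //; apply: leq_trans xN; exact: leq_addl.
have := uniq_leq_size ul sl; rewrite /= size_map.
rewrite (@stable_fromE _ _ _ n (n - size c) v st) ?ltnn //; lia.
Qed.

End Counting.

Section EDL.
Local Open Scope nat_scope.
Variables (E : digraph) (s : seq (edge E)).
Hypotheses (us : uniq s) (s_all : forall e, e \in s) (ns : no_sinks E).
Local Notation num n v := (size (paths_to s n v)).

Lemma stable_EDL N : stable_from s N -> EDL E.
Proof.
move=> st c cc v cv; have ne := stable_no_exit us s_all ns st.
exists (num N v); first exact: (num_gt0 s_all N cc cv).
move=> i ic; have c0 := size_cycle_gt0 cc.
(* A length congruent to [i] that exceeds those of all arrivals. *)
pose n := (N + size c) * size c + i.
have ni : n %% size c = i by rewrite modnMDl modn_small.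
have Nn : N + size c <= n by rewrite /n; nia.
have := @arrivals_count _ _ us s_all ne _ _ cc cv n.
rewrite ni (stable_fromE v st (n := N)) //; last by lia.
apply=> x ax; have := stable_arrivals_bounded us s_all ne cc cv st ax.
lia.
Qed.

(** On a cycle, (EDL) bounds the lengths of the finitely many arrivals, and
    beyond this bound [num n v] is the constant of (EDL).  A vertex outside of
    the cycles ends no path longer than the number of vertices, as such a path
    would run into a cycle. *)
Lemma EDL_num_stable : no_exit E -> EDL E ->
  forall v, exists N, forall n, N <= n -> num n.+1 v = num n v.
Proof.
move=> ne edl v.
have [[c [cc cv]]|nc] := pselect (exists c, is_cycle c /\ on_cycle c v).
  have c0 := size_cycle_gt0 cc.
  have [k _ kP] := edl c cc v cv.
  have bounded i : exists b, i < size c ->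
      forall x, arrivals c v i x -> size x.2 <= b.
    have [ic|ic] := ltnP i (size c); last by exists 0.
    have /finite_seqP[l lE] : finite_set (arrivals c v i).
      by apply/finite_setP; exists k; exact: kP.
    exists (\max_(x <- l) size x.2) => _ x; rewrite lE => xl.
    exact: (leq_bigmax_seq (F := fun x => size x.2)).
  have [B BP] := choice bounded; pose N := \max_(i < size c) B i.
  have numk n : N <= n -> num n v = k.
    move=> Nn; have nc : n %% size c < size c by rewrite ltn_mod.
    have := kP _ nc; rewrite -/(arrivals c v _) => h.
    apply/card_eq_II; apply: card_eq_trans h; rewrite card_eq_sym.
    apply: arrivals_count => // x ax; apply: leq_trans Nn.
    apply: leq_trans (BP _ nc _ ax) _.
    exact: (leq_bigmax (Ordinal nc)).
  by exists N => n Nn; rewrite !numk // ltnW.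
exists #|vert E|.+1 => n; suff num0 m : #|vert E| < m -> num m v = 0.
  by move=> vn; rewrite !num0 // ltnW.
move=> vm; case l : (paths_to s m v) => [//|[w p] r]; exfalso.
have : (w, p) \in paths_to s m v by rewrite l mem_head.
rewrite mem_paths_to //= => /and3P[wp /eqP pv /eqP pm].
have : ~~ uniq [seq src e | e <- p].
  apply/negP => /card_uniqP cu; move: vm.
  by rewrite ltnNge -pm -(size_map (@src E)) -cu max_card.
move=> /(nonuniq_cycle wp)[p1 [c [p2 [pE cc]]]].
have /and3P[] := cc; case cE : c => [//|e c'] _ _ _.
apply: nc; exists c; split=> //.
have ce : on_cycle c (src e) by rewrite cE /on_cycle /= mem_head.
move: wp pv; rewrite pE is_path_cat path_end_cat => /andP[_ pp] <-.
have pE' : path_end w p1 = src e by move: pp; rewrite cE /= => /andP[/eqP].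
by rewrite pE' in pp *; exact: path_on_cycle.
Qed.

Lemma EDL_stable : no_exit E -> EDL E -> exists N, stable_from s N.
Proof.
move=> ne edl; have [N NP] := choice (EDL_num_stable ne edl).
exists (\max_v N v) => n v Nn; apply: NP; apply: leq_trans Nn.
exact: leq_bigmax.
Qed.

End EDL.

(** * The three conditions *)

Section Equivalences.
Variables (E : digraph) (K : fieldType).
Local Notation C := (@lpa_component E K).

Lemma finite_graph_enum : finite_graph E ->
  exists2 s : seq (edge E), uniq s & forall e, e \in s.
Proof.
move=> /finite_seqP[s sE]; exists (undup s); first exact: undup_uniq.
move=> e; rewrite mem_undup.
by have : [set` s]%classic e by rewrite -sE.
Qed.

Lemma crossed_product_graph : crossed_product C ->
  [/\ finite_graph E, no_exit E, no_sinks E & EDL E].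
Proof.
move=> /(_ 1)[u Cu [u' [uu' u'u]]].
have fin := unit_degree1_finite Cu uu'; have ns := unit_degree1_no_sinks Cu uu'.
have [s us s_all] := finite_graph_enum fin.
have [N st] := unit_degree1_stable us s_all ns Cu uu' u'u.
by split=> //; [exact: stable_no_exit st | exact: stable_EDL st].
Qed.

Lemma graph_strongly_graded_unit_regular :
  [/\ finite_graph E, no_exit E, no_sinks E & EDL E] ->
  strongly_graded C /\ graded_unit_regular C.
Proof.
move=> [fin ne ns edl]; have [s us s_all] := finite_graph_enum fin.
have [N st] := EDL_stable us s_all ne edl.
split; first exact: stable_strongly_graded st.
exact: stable_graded_unit_regular st.
Qed.

(** A nonzero element of degree [- g] exists because [1] is a sum of products of
    elements of degrees [g] and [- g]; regularity supplies a unit of degree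
    [g]. *)
Lemma strongly_graded_unit_regular_crossed :
  strongly_graded C -> graded_unit_regular C -> crossed_product C.
Proof.
move=> sg gur g; have [z10|nz] := pselect (1 = 0 :> lpa E K).
  exists 0; first exact: span0.
  by exists 0; rewrite mulr0.
have : set_mul (C g) (C (- g)) 1 by rewrite sg subrr; exact: component1.
move=> [r rC rE].
have [b Cb b0] : exists2 b, C (- g) b & b <> 0.
  apply: contrapT => nb; apply: nz; rewrite rE big_seq big1 // => y /rC[_ Cy].
  have [->|y0] := pselect (y.2 = 0); first by rewrite mulr0.
  by case: nb; exists y.2.
have [u [Cu iu] _] := gur _ _ Cb b0.
by exists u => //; rewrite opprK in Cu.
Qed.

End Equivalences.

Theorem corollary5p3 (E : digraph) (K : fieldType) :
  (crossed_product (@lpa_component E K) <->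
     [/\ finite_graph E, no_exit E, no_sinks E & EDL E]) /\
  ([/\ finite_graph E, no_exit E, no_sinks E & EDL E] <->
     strongly_graded (@lpa_component E K) /\
     graded_unit_regular (@lpa_component E K)).
Proof.
have graph_regular := @graph_strongly_graded_unit_regular E K.
have regular_crossed :
    strongly_graded (@lpa_component E K) /\
    graded_unit_regular (@lpa_component E K) ->
  crossed_product (@lpa_component E K).
  by move=> [sg gur]; exact: strongly_graded_unit_regular_crossed.
split; split.
- exact: crossed_product_graph.
- by move=> /graph_regular/regular_crossed.
- exact: graph_regular.
- by move=> /regular_crossed/crossed_product_graph.
Qed.
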